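(* (i) The operator ideal $\mathscr{W}$ of weakly compact operators is a proper subclass of $\mathscr{WCG}$. (ii) Each of the operator ideals $\mathscr{V}$ (completely continuous operators), $\mathscr{S}$ (strictly singular operators) and $\mathscr{CS}$ (strictly cosingular operators) is incomparable to $\mathscr{WCG}$; that is, for each $\mathscr{J}\in\{\mathscr{V},\mathscr{S},\mathscr{CS}\}$ we have $\mathscr{J}\not\subseteq\mathscr{WCG}$ and $\mathscr{WCG}\not\subseteq\mathscr{J}$.
   Context: Operators are bounded linear maps between Banach spaces. A Banach space is weakly compactly generated (WCG) if it contains a weakly compact subset whose linear span is dense. An operator $T\colon E\to F$ belongs to $\mathscr{WCG}$ if there is a closed subspace $Z$ of $F$ that is a WCG Banach space and satisfies $T(E)\subseteq Z$. An operator $T\colon E\to F$ is: completely continuous if it maps weakly convergent sequences in $E$ to norm convergent sequences in $F$; strictly singular if it is not bounded below on any closed infinite-dimensional subspace of $E$ (bounded below: $\|Tx\|\geqslant\gamma\|x\|$ for some constant $\gamma>0$ and all $x$ in the subspace); strictly cosingular if for each closed subspace $M$ of $F$ of infinite codimension the operator $\pi T$ is not surjective, where $\pi\colon F\to F/M$ is the quotient map. *)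

(* Defs.v *)
From HB Require Import structures.
From mathcomp Require Import all_boot all_order all_algebra.
From mathcomp Require Import complex.
From mathcomp Require Import all_classical all_reals all_analysis.

Set Implicit Arguments.
Unset Strict Implicit.
Unset Printing Implicit Defensive.

Import Order.TTheory GRing.Theory Num.Theory.
Import numFieldNormedType.Exports.

Local Open Scope classical_set_scope.
Local Open Scope ring_scope.

Variant scalar_field (R : realType) : numFieldType -> Prop :=
| RealScalars : scalar_field R R
| ComplexScalars : scalar_field R R[i]%C.

(* The norm of a [normedModType K] takes its values in [K] itself; for complex
   scalars the values lie on the nonnegative real half-line, and [0 < c] means
   that [c] is real and positive. *)

Section Operators.
Context {K : numFieldType}.

Record operator (E F : normedModType K) := Operator {
  op_fun :> {linear E -> F};
  op_bounded : exists M : K, forall x : E, `|op_fun x| <= M * `|x| }.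

Definition dual_space (E : normedModType K) := operator E K^o.

Definition weak (E : normedModType K) := sup_topology (fun f : dual_space E =>
  Topological.class (initial_topology (f : E -> K^o))).

HB.instance Definition _ (E : normedModType K) := Topological.on (weak E).

Definition lin_span (E : normedModType K) (A : set E) : set E :=
  [set x | exists (n : nat) (a : 'I_n -> K) (v : 'I_n -> E),
     (forall i, A (v i)) /\ x = \sum_(i < n) a i *: v i].

Definition is_wcg (E : completeNormedModType K) : Prop :=
  exists A : set E, compact (A : set (weak E)) /\ dense (lin_span A).

Record closedSubspace (E : normedModType K) := ClosedSubspace {
  cs_set :> set E;
  cs_submod : submod_closed [pred x | x \in cs_set];
  cs_closed : closed cs_set }.

Definition infinite_dim (E : normedModType K) (M : closedSubspace E) : Prop :=
  ~ exists2 A : set E, finite_set A & M = lin_span A :> set E.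

(* The quotient space by [M] is the set [range (quotient_map M)] of cosets. *)
Definition quotient_map (E : normedModType K) (M : closedSubspace E) (y : E) :
    set E := [set z | cs_set M (z - y)].

(* As the quotient map is linear, it maps the span of [A] onto the span of the
   cosets of the points of [A]. *)
Definition infinite_codim (E : normedModType K) (M : closedSubspace E) : Prop :=
  ~ exists2 A : set E, finite_set A &
      range (quotient_map M) `<=` quotient_map M @` lin_span A.

End Operators.

(* [subspace_banach Z] carries the norm restricted from [E], so that
   [weak (subspace_banach Z)] is defined by the dual space of [Z] itself. *)
Section SubspaceBanach.
Context {K : numFieldType} (E : completeNormedModType K) (Z : closedSubspace E).

Definition subspace_pred : {pred E} := [pred x | x \in (Z : set E)].

HB.instance Definition _ :=
  GRing.isSubmodClosed.Build K E subspace_pred (cs_submod Z).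

Record subspace_banach := SubspaceBanach {
  subspace_val :> E; _ : subspace_val \in subspace_pred }.

HB.instance Definition _ := [isSub for subspace_val].
HB.instance Definition _ := [Choice of subspace_banach by <:].
HB.instance Definition _ := [SubChoice_isSubLmodule of subspace_banach by <:].

Let norm (x : subspace_banach) : K := `|val x|.

Let norm_triangle x y : norm (x + y) <= norm x + norm y.
Proof. exact: ler_normD. Qed.

Let norm_scale (l : K) x : norm (l *: x) = `|l| * norm x.
Proof. exact: normrZ. Qed.

Let norm_eq0 x : norm x = 0 -> x = 0.
Proof. by move=> /normr0_eq0 x0; exact: val_inj. Qed.

HB.instance Definition _ :=
  Lmodule_isNormed.Build K subspace_banach norm_triangle norm_scale norm_eq0.

Lemma subspace_normE (x : subspace_banach) : `|x| = `|val x|.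
Proof. by []. Qed.

Lemma subspace_ballE (x y : subspace_banach) (e : K) :
  ball x e y = ball (val x) e (val y).
Proof. by rewrite -!ball_normE. Qed.

Let subspace_complete (F : set_system subspace_banach) :
  ProperFilter F -> cauchy F -> cvg F.
Proof.
move=> FF /cauchyP Fc.
have : cvg ((val : subspace_banach -> E) @ F).
  apply: cauchy_cvg; apply/cauchyP => e e0.
  have [x Fx] := Fc e e0; exists (val x).
  suff : F (val @^-1` ball (val x) e) by [].
  by apply: filterS Fx => y; rewrite subspace_ballE.
move=> /cvg_ex[l Fl].
have Zl : cs_set Z l.
  apply: (@closed_cvg _ _ F _ (val : subspace_banach -> E) (cs_set Z) _ _ l Fl).
    exact: cs_closed.
  by apply: nearW => -[x xZ] /=; exact: set_mem.
have lZ : l \in subspace_pred by apply: mem_set.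
apply/cvg_ex; exists (SubspaceBanach lZ).
apply/cvg_ballP => e e0; have /cvg_ballP/(_ e e0) := Fl.
by apply: filterS => x; rewrite subspace_ballE.
Qed.

HB.instance Definition _ :=
  Uniform_isComplete.Build subspace_banach subspace_complete.

End SubspaceBanach.

Section OperatorClasses.
Context {K : numFieldType}.

Definition operator_class :=
  forall E F : completeNormedModType K, operator E F -> Prop.

Definition subclass (I J : operator_class) : Prop :=
  forall (E F : completeNormedModType K) (T : operator E F), I E F T -> J E F T.

Definition proper_subclass (I J : operator_class) : Prop :=
  subclass I J /\ ~ subclass J I.

Definition incomparable (I J : operator_class) : Prop :=
  ~ subclass I J /\ ~ subclass J I.

Definition weakly_compact_op : operator_class := fun E F T =>
  precompact (T @` [set x | `|x| <= 1] : set (weak F)).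

Definition wcg_op : operator_class := fun E F T =>
  exists Z : closedSubspace F, is_wcg (subspace_banach Z) /\ range T `<=` Z.

Definition completely_continuous : operator_class := fun E F T =>
  forall (u : nat -> E) (l : E),
    (u : nat -> weak E) @ \oo --> (l : weak E) -> cvg (T \o u @ \oo).

Definition bounded_below_on (E F : completeNormedModType K)
    (T : operator E F) (M : closedSubspace E) : Prop :=
  exists2 c : K, 0 < c & forall x, cs_set M x -> c * `|x| <= `|T x|.

Definition strictly_singular : operator_class := fun E F T =>
  forall M : closedSubspace E, infinite_dim M -> ~ bounded_below_on T M.

Definition strictly_cosingular : operator_class := fun E F T =>
  forall M : closedSubspace F, infinite_codim M ->
    ~ set_surj [set: E] (range (quotient_map M)) (quotient_map M \o T).

End OperatorClasses.

Arguments weakly_compact_op K : clear implicits.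
Arguments wcg_op K : clear implicits.
Arguments completely_continuous K : clear implicits.
Arguments strictly_singular K : clear implicits.
Arguments strictly_cosingular K : clear implicits.

(* Main.v *)
Require Import Defs.
From HB Require Import structures.
From mathcomp Require Import all_boot all_order all_algebra.
From mathcomp Require Import complex.
From mathcomp Require Import all_classical all_reals all_analysis.
From mathcomp Require Import ring lra.

(* Weakly compact operators belong to WCG: the closure of the range is generated
   by the weak closure of the image of the unit ball. The identity of c_0 belongs
   to WCG and to none of W, V, S, CS.

   One operator shows that none of V, S, CS is contained in WCG, namely
   T : l^1(R) -> l^oo(Q), which maps the unit vector at t to the indicator
   function v_t of {q | t <= q}.
   - T is not in WCG: a weakly compact subset of l^oo(Q) is weakly metrizable, so
     that WCG subspaces of l^oo(Q) are separable, whereas |v_s - v_t| = 1 for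
     s <> t.
   - T is completely continuous, because l^1(R) has the Schur property.
   - If T is bounded below on M, then each h = T x with x in M satisfies
     Var h <= C sup |h|. If T is onto modulo M, then by uniform boundedness each
     h(t) = f(v_t) with f in the annihilator of M satisfies the same inequality.
     A linear space of functions on a totally ordered set on which the variation
     is dominated by the supremum is finite-dimensional. *)

Set Implicit Arguments.
Unset Strict Implicit.
Unset Printing Implicit Defensive.

Import Order.TTheory GRing.Theory Num.Theory.
Import numFieldNormedType.Exports.

Local Open Scope classical_set_scope.
Local Open Scope ring_scope.

(** * Scalars *)

(** The step functions are monotone in both variables, [q -> v_t(q)] and [t -> v_t(q)]. So a
    combination of their increments along a chain, with coefficients of modulus at most 1, is
    bounded by 1 at every point. In one variable this controls the variation of [T x] by the norm of
    [x]; in the other it controls the variation of [t -> f(v_t)] by the norm of [f]. Strict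
    singularity and strict cosingularity thus become one statement about functions on a chain, used
    over Q and over R. The two index sets have different duties: R is uncountable, so the range of
    [T] is nonseparable, while Q is countable, so that a sequence of functionals separates the
    points of l^oo(Q). Compactness cannot give the statement about chains: the [v_t] themselves have
    variation and supremum 1 and mutual distance 1. Linearity has to enter quantitatively, through
    random signs: for signed sums of [n] well-chosen functions, the variation grows faster than the
    supremum. Real and complex scalars are treated together through the interface [scalars], where
    [iu] stands for the imaginary unit. *)

Record scalars (R : realType) (K : numFieldType) := Scalars {
  rl : {rmorphism R -> K};
  re : K -> R;
  nrm : K -> R;
  iu : K;
  rl_le : forall a b, (rl a <= rl b) = (a <= b);
  nrmE : forall x, `|x| = rl (nrm x);
  reD : forall x y, re (x + y) = re x + re y;
  reZ : forall a x, re (rl a * x) = a * re x;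
  re1 : re 1 = 1;
  re_le : forall x, `|re x| <= nrm x;
  reE : forall x, x = rl (re x) - iu * rl (re (iu * x));
  iu2 : iu = 0 \/ iu * iu = -1;
  parallelogram : forall x y,
    nrm (x + y) ^+ 2 + nrm (x - y) ^+ 2 = (nrm x ^+ 2 + nrm y ^+ 2) *+ 2 }.

(** Taking [iu = 0] lets real scalars share the arguments written for complex ones: in [reE], or in
    the complexification inside [hahn_banach], the imaginary part then disappears. *)
Lemma real_scalars (R : realType) : scalars R R.
Proof.
apply: (@Scalars R R idfun idfun (fun x => `|x|) 0) => //.
- by move=> x; rewrite mul0r subr0.
- by left.
by move=> x y; rewrite !real_normK ?num_real// !expr2; ring.
Qed.

Lemma complex_scalars (R : realType) : scalars R R[i]%C.
Proof.
apply: (@Scalars R R[i]%C (real_complex R) (@complex.Re R)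
  (fun x => Num.sqrt (complex.Re x ^+ 2 + complex.Im x ^+ 2)) 'i%C).
- exact: lecR.
- exact: normc_def.
- by move=> [a b] [c d].
- by move=> a [c d] /=; rewrite mul0r subr0.
- by [].
- move=> [a b] /=; rewrite -sqrtr_sqr ler_wsqrtr// lerDl; exact: sqr_ge0.
- move=> [a b]; rewrite /real_complex_def; simpc.
  by rewrite /= ?mul0r ?mul1r ?sub0r ?subr0 ?addr0 ?add0r ?opprK.
- by right; rewrite -expr2 sqr_i.
- move=> [a b] [c d] /=.
  by rewrite !sqr_sqrtr ?addr_ge0 ?sqr_ge0// !expr2; ring.
Qed.

Lemma scalars_of_scalar_field (R : realType) (K : numFieldType) :
  scalar_field R K -> inhabited (scalars R K).
Proof.
by case; constructor; [exact: real_scalars|exact: complex_scalars].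
Qed.

Section Scalars.
Context (R : realType) (K : numFieldType) (S : scalars R K).
Local Notation rl := (rl S).
Local Notation re := (re S).
Local Notation nrm := (nrm S).
Local Notation iu := (iu S).

Lemma rl_inj : injective rl. Proof. exact: fmorph_inj. Qed.

Lemma rl_lt a b : (rl a < rl b) = (a < b).
Proof. by rewrite !lt_neqAle rl_le (inj_eq rl_inj). Qed.

Lemma rl_ge0 a : (0 <= rl a) = (0 <= a).
Proof. by rewrite -(rmorph0 rl) rl_le. Qed.

Lemma rl_gt0 a : (0 < rl a) = (0 < a).
Proof. by rewrite -(rmorph0 rl) rl_lt. Qed.

Lemma nrm_ge0 x : 0 <= nrm x.
Proof. by rewrite -rl_ge0 -nrmE. Qed.

Lemma rl_nrm_id x : 0 <= x -> x = rl (nrm x).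
Proof. by move=> x0; rewrite -nrmE ger0_norm. Qed.

Lemma nrm_rl a : nrm (rl a) = `|a|.
Proof.
apply: rl_inj; rewrite -nrmE; have [a0|a0] := leP 0 a.
  by rewrite (ger0_norm a0) ger0_norm// rl_ge0.
rewrite (ltr0_norm a0) rmorphN ler0_norm//.
by rewrite -oppr_ge0 -rmorphN rl_ge0 oppr_ge0 ltW.
Qed.

Section Norm.
Context (E : normedModType K).
Implicit Types x y z : E.

(** The norm of [E] takes values in [K]; this real-valued copy admits suprema and real
    arithmetic. *)
Definition nv x : R := nrm `|x|.

Lemma nvE x : `|x| = rl (nv x).
Proof. by rewrite /nv -nrmE normr_id. Qed.

Lemma nv_ge0 x : 0 <= nv x. Proof. exact: nrm_ge0. Qed.

Lemma nvD x y : nv (x + y) <= nv x + nv y.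
Proof. by rewrite -(rl_le S) rmorphD -!nvE ler_normD. Qed.

Lemma nvZ k x : nv (k *: x) = nrm k * nv x.
Proof. by apply: rl_inj; rewrite rmorphM -!nvE -nrmE normrZ. Qed.

Lemma nvN x : nv (- x) = nv x.
Proof. by rewrite /nv normrN. Qed.

Lemma nv0 : nv 0 = 0.
Proof. by apply: rl_inj; rewrite rmorph0 -nvE normr0. Qed.

Lemma nv_eq0 x : nv x = 0 -> x = 0.
Proof. by move=> x0; apply/normr0_eq0; rewrite nvE x0 rmorph0. Qed.

Lemma nv_gt0 x : x <> 0 -> 0 < nv x.
Proof.
by move=> x0; rewrite lt_neqAle nv_ge0 andbT eq_sym; apply/eqP => /nv_eq0.
Qed.

Lemma nvB x y : nv (x - y) = nv (y - x).
Proof. by rewrite -nvN opprB. Qed.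

Lemma nv_trans y x z : nv (x - z) <= nv (x - y) + nv (y - z).
Proof. by rewrite -[x - z](subrKA y); exact: nvD. Qed.

Lemma nv_nbhs x (A : set E) :
  nbhs x A <-> exists2 e : R, 0 < e & forall y, nv (x - y) < e -> A y.
Proof.
split.
  move=> /nbhs_normP[e /= e0 eA]; exists (nrm e).
    by rewrite -rl_gt0 -rl_nrm_id// ltW.
  move=> y xy; apply: eA => /=.
  by rewrite (rl_nrm_id (ltW e0)) nvE rl_lt.
move=> [e e0 eA]; apply/nbhs_normP; exists (rl e) => /=; first by rewrite rl_gt0.
by move=> y /=; rewrite nvE rl_lt; exact: eA.
Qed.

Lemma nv_cvg (T : Type) (F : set_system T) (f : T -> E) (l : E) : Filter F ->
  f @ F --> l <-> forall e : R, 0 < e -> F [set t | nv (l - f t) < e].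
Proof.
move=> FF; split=> [fl e e0|H A /nv_nbhs[e e0 eA]].
  by apply: (fl [set y | nv (l - y) < e]); apply/nv_nbhs; exists e.
by apply: filterS (H e e0) => t; exact: eA.
Qed.

End Norm.

Lemma nv_K (k : K^o) : nv k = nrm k.
Proof. by apply: rl_inj; rewrite -nvE -nrmE. Qed.

Lemma nrmD k l : nrm (k + l) <= nrm k + nrm l.
Proof. by have := nvD (k : K^o) l; rewrite !nv_K. Qed.

Lemma nrmN k : nrm (- k) = nrm k.
Proof. by have := nvN (k : K^o); rewrite !nv_K. Qed.

Lemma nrmM k l : nrm (k * l) = nrm k * nrm l.
Proof. by have := nvZ k (l : K^o); rewrite !nv_K. Qed.

Lemma nrm0 : nrm 0 = 0.
Proof. by have := nv0 K^o; rewrite !nv_K. Qed.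

Lemma nrm1 : nrm 1 = 1.
Proof. by rewrite -(rmorph1 rl) nrm_rl normr1. Qed.

Lemma nrm_eq0 k : nrm k = 0 -> k = 0.
Proof. by move=> k0; apply: (@nv_eq0 K^o); rewrite nv_K. Qed.

Lemma nrm_gt0 k : k <> 0 -> 0 < nrm k.
Proof. by move=> k0; rewrite -nv_K; exact: nv_gt0. Qed.

Lemma nrmB k l : nrm (k - l) = nrm (l - k).
Proof. by rewrite -nrmN opprB. Qed.

Lemma nrmV k : nrm k^-1 = (nrm k)^-1.
Proof. by apply: rl_inj; rewrite fmorphV -!nrmE normfV. Qed.

Lemma nrm_iu : nrm iu <= 1.
Proof.
case: (iu2 S) => [->|i2]; first by rewrite nrm0.
have : nrm iu * nrm iu = 1 by rewrite -nrmM i2 nrmN nrm1.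
by have := nrm_ge0 iu; nra.
Qed.

Lemma re0 : re 0 = 0.
Proof. by rewrite -(mul0r 0) -(rmorph0 rl) reZ mul0r. Qed.

Lemma reN x : re (- x) = - re x.
Proof. by rewrite -mulN1r -(rmorph1 rl) -rmorphN reZ mulN1r. Qed.

Lemma reB x y : re (x - y) = re x - re y.
Proof. by rewrite reD reN. Qed.

(** Completeness is inherited from [R] along the contractions [x -> re x] and [x -> re (iu * x)],
    from whose limits [reE] rebuilds the limit in [K]. *)
Lemma scalar_complete (F : set_system K) : ProperFilter F ->
  (forall e : R, 0 < e -> exists a, F [set x | nrm (x - a) < e]) ->
  exists l, forall e : R, 0 < e -> F [set x | nrm (l - x) < e].
Proof.
move=> FF Fc.
have cvgre (g : K -> R) : (forall x y, `|g x - g y| <= nrm (x - y)) ->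
    exists l : R, forall e : R, 0 < e -> F [set x | `|l - g x| < e].
  move=> gl; have : cvg (g @ F).
    apply: cauchy_cvg; apply/cauchyP => e e0.
    have [a Fa] := Fc e e0; exists (g a).
    suff : F (g @^-1` ball (g a) e) by [].
    apply: filterS Fa => x /= xa; rewrite -ball_normE /= distrC.
    exact: le_lt_trans xa.
  move=> /cvg_ex[l Fl]; exists l => e e0.
  by have /cvgrPdist_lt/(_ e e0) := Fl.
have [a Fa] : exists l : R, forall e : R, 0 < e -> F [set x | `|l - re x| < e].
  by apply: cvgre => x y; rewrite -reB re_le.
have [b Fb] : exists l : R, forall e : R, 0 < e ->
    F [set x | `|l - re (iu * x)| < e].
  apply: cvgre => x y; rewrite -reB -mulrBr (le_trans (re_le _ _))// nrmM.
  by rewrite ler_piMl ?nrm_ge0 ?nrm_iu.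
exists (rl a - iu * rl b) => e e0.
have e2 : 0 < e / 2 by lra.
apply: filterS2 (Fa _ e2) (Fb _ e2) => x /= ax bx.
rewrite [x in _ - x](reE S).
rewrite (_ : _ - _ = rl (a - re x) - iu * rl (b - re (iu * x))); last first.
  by rewrite !rmorphB mulrBr; ring.
apply: (le_lt_trans (nrmD _ _)); rewrite nrmN nrmM !nrm_rl.
have := nrm_iu; have := nrm_ge0 iu; have := normr_ge0 (b - re (iu * x)); nra.
Qed.

Lemma scalar_separable : exists q : nat -> K,
  forall x (e : R), 0 < e -> exists n, nrm (x - q n) < e.
Proof.
pose g (r : rat * rat) : K := rl (ratr r.1) - iu * rl (ratr r.2).
exists (fun n => if unpickle n is Some r then g r else 0) => x e e0.
have den (a : R) : exists r : rat, `|a - ratr r| < e / 2.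
  have : a - e / 2 < a + e / 2 by lra.
  move=> /rat_in_itvoo[r]; rewrite in_itv /= => /andP[r1 r2].
  by exists r; rewrite ltr_norml; apply/andP; split; lra.
have [r1 h1] := den (re x); have [r2 h2] := den (re (iu * x)).
exists (pickle (r1, r2)); rewrite pickleK /g /= [X in X - _](reE S).
rewrite (_ : _ - _ = rl (re x - ratr r1) - iu * rl (re (iu * x) - ratr r2)).
  apply: (le_lt_trans (nrmD _ _)); rewrite nrmN nrmM !nrm_rl.
  by have := nrm_iu; have := nrm_ge0 iu; have := normr_ge0 (re (iu * x) - ratr r2); nra.
by rewrite !rmorphB mulrBr; ring.
Qed.

End Scalars.

(** * Random signs *)

Section Signs.
Context (R : realType).

(** Expectation over [n] independent fair signs, computed by conditioning on the first one, so that
    moment estimates go by induction on the list of coefficients. *)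
Fixpoint sign_mean n (F : seq bool -> R) : R :=
  if n is n'.+1 then
    (sign_mean n' (F \o cons true) + sign_mean n' (F \o cons false)) / 2
  else F [::].

Lemma sign_mean_le n F G : (forall b, F b <= G b) ->
  sign_mean n F <= sign_mean n G.
Proof.
elim: n F G => [|n IH] F G FG //=.
by rewrite ler_pM2r ?invr_gt0// lerD// IH => // b; exact: FG.
Qed.

Lemma sign_meanD n F G :
  sign_mean n (fun b => F b + G b) = sign_mean n F + sign_mean n G.
Proof.
elim: n F G => [|n IH] F G //=.
by rewrite (IH (F \o cons true)) (IH (F \o cons false)); lra.
Qed.

Lemma sign_mean_cst n c : sign_mean n (fun=> c) = c.
Proof. by elim: n => [|n /= ->] //; lra. Qed.

Lemma sign_meanZ n c F : sign_mean n (fun b => c * F b) = c * sign_mean n F.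
Proof.
elim: n F => [|n IH] F //=.
by rewrite (IH (F \o cons true)) (IH (F \o cons false)); lra.
Qed.

Lemma sign_mean_sum n (T : Type) (s : seq T) (F : T -> seq bool -> R) :
  sign_mean n (fun b => \sum_(x <- s) F x b) = \sum_(x <- s) sign_mean n (F x).
Proof.
elim: s => [|x s IH].
  rewrite big_nil -[RHS](sign_mean_cst n); congr sign_mean.
  by apply/funext => b; rewrite big_nil.
rewrite big_cons -IH -sign_meanD; congr sign_mean.
by apply/funext => b; rewrite big_cons.
Qed.

Context (K : numFieldType) (S : scalars R K).
Local Notation nrm := (nrm S).

Fixpoint sign_sum (b : seq bool) (c : seq K) : K :=
  match b, c with
  | e :: b', a :: c' => (if e then a else - a) + sign_sum b' c'
  | _, _ => 0
  end.

Lemma nrmMn2 x : nrm x *+ 2 = nrm (x + x).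
Proof.
by rewrite -mulr2n -(mulr_natl x) -(rmorph_nat (rl S)) nrmM nrm_rl normr_nat mulr_natl.
Qed.

(** Jensen's inequality: the random sum has mean zero, so adding it to [s] cannot lower the mean
    norm. *)
Lemma sign_mean_nrm_ge (c : seq K) s :
  nrm s <= sign_mean (size c) (fun b => nrm (s + sign_sum b c)).
Proof.
elim: c s => [|a c IH] s /=; first by rewrite addr0.
have h e : sign_mean (size c) ((fun b => nrm (s + sign_sum b (a :: c))) \o cons e) =
    sign_mean (size c) (fun b => nrm (s + (if e then a else - a) + sign_sum b c)).
  by congr sign_mean; apply/funext => b /=; rewrite addrA.
rewrite !h; have := IH (s + a); have := IH (s - a).
have : nrm s *+ 2 <= nrm (s + a) + nrm (s - a).
  have -> : nrm s *+ 2 = nrm (s + s).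
    by rewrite nrmMn2.
  by rewrite (_ : s + s = (s + a) + (s - a)) ?nrmD//; ring.
by rewrite mulr2n /=; lra.
Qed.

(** The two outcomes for the sign of [a] differ by [2a], so their norms average at least [nrm a]; by
    Jensen the later signs do not lower this. *)
Lemma sign_mean_nrm_ge_coef (c : seq K) a s : a \in c ->
  nrm a <= sign_mean (size c) (fun b => nrm (s + sign_sum b c)).
Proof.
elim: c s => [|a' c IH] s //=; rewrite inE => ac.
have h e : sign_mean (size c) ((fun b => nrm (s + sign_sum b (a' :: c))) \o cons e) =
    sign_mean (size c) (fun b => nrm (s + (if e then a' else - a') + sign_sum b c)).
  by congr sign_mean; apply/funext => b /=; rewrite addrA.
rewrite !h; case/orP: ac => [/eqP ->|ac].
  have /= := sign_mean_nrm_ge c (s + a'); have /= := sign_mean_nrm_ge c (s - a').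
  have : nrm a' *+ 2 <= nrm (s + a') + nrm (s - a').
    have -> : nrm a' *+ 2 = nrm (a' + a').
      by rewrite nrmMn2.
    rewrite (nrmB S s a') (_ : a' + a' = (s + a') + (a' - s)) ?nrmD//.
    by rewrite addrC; ring.
  by rewrite mulr2n; lra.
by have /= := IH (s + a') ac; have /= := IH (s - a') ac; lra.
Qed.

(** Write [X], [Y] for the squared norms of [s + a], [s - a], and [u], [v] for the norms of [s],
    [a]. The parallelogram law places [X] and [Y] symmetrically about [u^2 + v^2], the triangle
    inequality bounds their deviation by [2uv], and squaring gives the claim. *)
Lemma nrm4_parallelogram s a : nrm (s + a) ^+ 4 + nrm (s - a) ^+ 4 <=
  (nrm s ^+ 4 + 6 * nrm s ^+ 2 * nrm a ^+ 2 + nrm a ^+ 4) *+ 2.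
Proof.
have hp := parallelogram S s a.
have h1 := nrmD S s a; have h2 := nrmD S s (- a); rewrite nrmN in h2.
move: (nrm_ge0 S (s + a)) (nrm_ge0 S (s - a)) (nrm_ge0 S s) (nrm_ge0 S a) h1 h2 hp.
set x := nrm (s + a); set y := nrm (s - a); set u := nrm s; set v := nrm a.
move=> x0 y0 u0 v0 xuv yuv; rewrite !mulr2n => hp.
have e4 (z : R) : z ^+ 4 = (z ^+ 2) ^+ 2 by rewrite -exprM.
rewrite !e4.
have hx : x ^+ 2 <= (u + v) ^+ 2 by rewrite lerXn2r// nnegrE addr_ge0.
have hy : y ^+ 2 <= (u + v) ^+ 2 by rewrite lerXn2r// nnegrE addr_ge0.
move: hx hy hp; set X := x ^+ 2; set Y := y ^+ 2 => hx hy hp.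
have d1 : X - (u ^+ 2 + v ^+ 2) <= 2 * (u * v).
  by move: hx; rewrite !expr2 mulrDl !mulrDr (mulrC v u); lra.
have d2 : - (2 * (u * v)) <= X - (u ^+ 2 + v ^+ 2).
  by move: hy hp; rewrite !expr2 mulrDl !mulrDr (mulrC v u); lra.
have hd : (X - (u ^+ 2 + v ^+ 2)) ^+ 2 <= (2 * (u * v)) ^+ 2.
  by rewrite -[X in X <= _]real_normK ?num_real// lerXn2r ?nnegrE ?mulr_ge0// ler_norml d1 d2.
have -> : Y = u ^+ 2 + v ^+ 2 - (X - (u ^+ 2 + v ^+ 2)) by move: hp; lra.
move: hd; rewrite exprMn exprMn; nra.
Qed.

(** The fourth-moment Khintchine inequality, with its usual constant 3. The offset [s] makes the
    induction close: each step moves the first signed coefficient into it. *)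
Lemma sign_mean_nrm4_le (B : R) (c : seq K) s : (forall a, a \in c -> nrm a <= B) ->
  sign_mean (size c) (fun b => nrm (s + sign_sum b c) ^+ 4) <=
  nrm s ^+ 4 + 6 * (size c)%:R * nrm s ^+ 2 * B ^+ 2 + 3 * (size c)%:R ^+ 2 * B ^+ 4.
Proof.
elim: c s => [|a c IH] s cB /=.
  by rewrite addr0 !(mulr0, mul0r) expr0n !(mulr0, mul0r) !addr0.
have h e : sign_mean (size c) ((fun b => nrm (s + sign_sum b (a :: c)) ^+ 4) \o cons e) =
    sign_mean (size c) (fun b => nrm (s + (if e then a else - a) + sign_sum b c) ^+ 4).
  by congr sign_mean; apply/funext => b /=; rewrite addrA.
have cB' x : x \in c -> nrm x <= B by move=> xc; apply: cB; rewrite inE xc orbT.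
rewrite !h; have /= := IH (s + a) cB'; have /= := IH (s - a) cB'.
have aB : nrm a <= B by apply: cB; rewrite inE eqxx.
have h4 := nrm4_parallelogram s a; have hp := parallelogram S s a.
rewrite !(mulr2n (_ + _)) in hp h4.
set r := (size c)%:R; have r0 : 0 <= r by exact: ler0n.
have a2 : nrm a ^+ 2 <= B ^+ 2 by rewrite lerXn2r ?nnegrE ?nrm_ge0// (le_trans (nrm_ge0 S a)).
have a4 : nrm a ^+ 4 <= B ^+ 2 * B ^+ 2.
  have -> : nrm a ^+ 4 = nrm a ^+ 2 * nrm a ^+ 2 by rewrite -exprD.
  by rewrite ler_pM ?exprn_ge0 ?nrm_ge0.
have -> : B ^+ 4 = B ^+ 2 * B ^+ 2 by rewrite -exprD.
move: (sqr_ge0 (nrm s)) (sqr_ge0 (nrm a)) (sqr_ge0 B) h4 hp a2 a4.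
set X := sign_mean _ _; set Y := sign_mean _ _.
set b2 := B ^+ 2; set A2 := nrm a ^+ 2; set u2 := nrm s ^+ 2.
set x4 := nrm (s + a) ^+ 4; set y4 := nrm (s - a) ^+ 4; set A4 := nrm a ^+ 4; set u4 := nrm s ^+ 4.
set x2 := nrm (s + a) ^+ 2; set y2 := nrm (s - a) ^+ 2.
move=> u20 A20 b20 h4 hp a2 a4 hY hX.
have e1 : u2 * A2 <= u2 * b2 by rewrite ler_wpM2l.
have e2 : r * b2 * (x2 + y2) <= r * b2 * ((u2 + b2) + (u2 + b2)).
  by apply: (ler_wpM2l (mulr_ge0 r0 b20)); lra.
have e3 : 0 <= b2 * b2 := mulr_ge0 b20 b20.
have -> : (size c).+1%:R = r + 1 :> R by rewrite natr1.
rewrite !expr2 in hX hY *; lra.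
Qed.

End Signs.

(** * Functions of bounded variation *)

Section BoundedVariation.
Context (R : realType) (K : numFieldType) (S : scalars R K).
Context (d : Order.disp_t) (P : orderType d).
Local Notation nrm := (nrm S).
Implicit Types (h g : P -> K) (p q : P) (s : seq P).

Fixpoint path_variation h p s : R :=
  if s is q :: s' then nrm (h q - h p) + path_variation h q s' else 0.

Definition variation h s : R := if s is p :: s' then path_variation h p s' else 0.

Lemma variationZ k h s : variation (fun p => k * h p) s = nrm k * variation h s.
Proof.
case: s => [|p s] /=; first by rewrite mulr0.
elim: s p => [|q s IH] p /=; first by rewrite mulr0.
by rewrite IH -mulrBr nrmM mulrDr.
Qed.

Lemma variation_far h p q (C : R) :
  (forall s, sorted <%O s -> variation h s <= C) -> nrm (h p - h q) <= C.
Proof.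
move=> hC; have [pq|qp|->] := ltgtP p q.
- by have := hC [:: p; q]; rewrite /= pq addr0 (nrmB S) => /(_ isT).
- by have := hC [:: q; p]; rewrite /= qp addr0 => /(_ isT).
by rewrite subrr nrm0; exact: (hC [::]).
Qed.

Local Notation far D l p q := (exists2 g, List.In g l & D < nrm (g p - g q)).

(** Sort the points: each consecutive pair contributes more than [D] to the variation of some
    function of [l], while all these variations together amount to at most [(size l) * C]. *)
Lemma separated_size (D C : R) (l : seq (P -> K)) s : 0 <= D ->
  (forall g, List.In g l -> forall s, sorted <%O s -> variation g s <= C) ->
  uniq s -> (forall p q, p \in s -> q \in s -> p != q -> far D l p q) ->
  D * (size s)%:R <= D + (size l)%:R * C.
Proof.
move=> D0 lC us fars.
have st : sorted <%O (sort <=%O s) by rewrite sort_lt_sorted.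
have ub : \sum_(g <- l) variation g (sort <=%O s) <= (size l)%:R * C.
  elim: l lC {fars} => [|g l IH] lC; first by rewrite big_nil mul0r.
  rewrite big_cons /= -natr1 mulrDl mul1r addrC lerD//.
    by apply: IH => g' g'l; apply: lC; right.
  by apply: lC => //; left.
suff : D * (size s)%:R <= D + \sum_(g <- l) variation g (sort <=%O s).
  by move=> /le_trans; apply; rewrite lerD2l.
have {}fars : forall p q, p \in sort <=%O s -> q \in sort <=%O s -> p != q -> far D l p q.
  by move=> p q; rewrite !mem_sort; exact: fars.
have {us} : uniq (sort <=%O s) by rewrite sort_uniq.
rewrite -(size_sort <=%O); case: (sort <=%O s) fars {ub st} => [|p t] fars ut /=.
  by rewrite mulr0 addr_ge0// sumr_ge0.
rewrite -natr1 mulrDr mulr1 addrC lerD2l.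
elim: t p fars ut => [|q t IH] p fars ut /=; first by rewrite mulr0 sumr_ge0.
rewrite big_split /= -natr1 mulrDr mulr1 addrC lerD//.
  apply: IH; last by case/andP: ut.
  by move=> a b aq bq; apply: fars; rewrite inE ?aq ?bq orbT.
have [|||g gl Dg] := fars p q; rewrite ?inE ?eqxx ?orbT//.
  by apply: contraTneq ut => ->; rewrite /= inE eqxx.
elim: l gl {fars IH lC} => [//|g' l IH] /= [->|gl]; rewrite big_cons.
  by rewrite (nrmB S) (le_trans (ltW Dg))// lerDl sumr_ge0// => i _; exact: nrm_ge0.
by rewrite (le_trans (IH gl))// lerDr nrm_ge0.
Qed.

(** A separated set that cannot be enlarged is a net; without a net of the stated size, separated
    sets would grow beyond the bound of [separated_size]. *)
Lemma finite_net (D C : R) (l : seq (P -> K)) : 0 < D -> 0 <= C ->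
  (forall g, List.In g l -> forall s, sorted <%O s -> variation g s <= C) ->
  exists s, D * (size s)%:R <= D + (size l)%:R * C /\
    forall p, exists2 q, q \in s & forall g, List.In g l -> nrm (g p - g q) <= D.
Proof.
move=> D0 C0 lC; apply: contrapT => nonet.
have sep n : exists s, [/\ size s = n, uniq s &
    forall p q, p \in s -> q \in s -> p != q -> far D l p q].
  elim: n => [|n [s [sn us fs]]]; first by exists [::].
  have [p ps] : exists p, forall q, q \in s -> far D l p q.
    apply: contrapT => nofar; apply: nonet; exists s; split.
      exact: separated_size (ltW D0) lC us fs.
    move=> p; apply: contrapT => nq; apply: nofar; exists p => q qs.
    apply: contrapT => nf; apply: nq; exists q => // g gl.
    by rewrite leNgt; apply/negP => Dg; apply: nf; exists g.
  exists (p :: s); split; first by rewrite /= sn.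
    rewrite /= us andbT; apply/negP => /ps[g _].
    by rewrite subrr nrm0 ltNge (ltW D0).
  move=> a b; rewrite !inE => /orP[/eqP ->|as_] /orP[/eqP ->|bs]; rewrite ?eqxx//.
  - by move=> _; exact: ps.
  - by move=> _; have [g gl Dg] := ps a as_; exists g => //; rewrite (nrmB S).
  - exact: fs.
pose M := (D + (size l)%:R * C) / D.
have [s [sn us fs]] := sep (Num.truncn M).+1.
have := separated_size (ltW D0) lC us fs.
rewrite sn mulrC -ler_pdivlMr// -/M leNgt => /negP; apply.
by rewrite truncnS_gt.
Qed.

(** A one-sided substitute for a biorthogonal system. It can be built one function at a time, and
    still makes some function of the list differ by exactly 1 in modulus between any two of the
    chosen points. *)
Fixpoint triangular (C : R) (l : seq ((P -> K) * P)) : Prop :=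
  if l is (g, t) :: l' then
    [/\ g t = 1, forall p, p \in map snd l' -> g p = 0,
        forall s, sorted <%O s -> variation g s <= C & triangular C l']
  else True.

Lemma triangular_uniq C l : triangular C l -> uniq (map snd l).
Proof.
elim: l => [//|[g t] l IH] /= [gt gl _ /IH ->]; rewrite andbT.
by apply/negP => /gl; rewrite gt => /eqP; rewrite oner_eq0.
Qed.

Lemma triangular_variation C l : triangular C l ->
  forall g, List.In g (map fst l) -> forall s, sorted <%O s -> variation g s <= C.
Proof.
elim: l => [//|[g t] l IH] /= [_ _ gC /IH{}IH] g' [<-//|]; exact: IH.
Qed.

Lemma triangular_far C l p q : triangular C l ->
  p \in map snd l -> q \in map snd l -> p != q ->
  exists2 a, a \in [seq x.1 q - x.1 p | x <- l] & nrm a = 1.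
Proof.
elim: l => [//|[g t] l IH] /= [gt gl _ /IH{}IH].
rewrite !inE => /orP[/eqP ->|pl] /orP[/eqP ->|ql]; rewrite ?eqxx// => pq.
- exists (g q - g t); first by rewrite inE eqxx.
  by rewrite gt (gl _ ql) sub0r nrmN nrm1.
- exists (g t - g p); first by rewrite inE eqxx.
  by rewrite gt (gl _ pl) subr0 nrm1.
- by have [a al a1] := IH pl ql pq; exists a => //; rewrite inE al orbT.
Qed.

Definition signed (l : seq ((P -> K) * P)) b p : K :=
  sign_sum b [seq x.1 p | x <- l].

Lemma signedB l b p q :
  signed l b p - signed l b q = sign_sum b [seq x.1 p - x.1 q | x <- l].
Proof.
rewrite /signed; elim: l b => [|x l IH] [|e b] //=; rewrite ?subrr//.
by rewrite -IH; case: e; ring.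
Qed.

Lemma sign_mean_variation C l s : triangular C l -> uniq s ->
  {subset s <= map snd l} ->
  (size s)%:R <= 1 + sign_mean (size l) (fun b => variation (signed l b) s).
Proof.
move=> tl; case: s => [|p s] us sl /=; first by rewrite sign_mean_cst addr0.
rewrite -natr1 addrC lerD2l.
elim: s p us sl => [|q s IH] p us sl /=; first by rewrite sign_mean_cst.
rewrite sign_meanD -natr1 addrC lerD//; last first.
  apply: IH; first by case/andP: us.
  by move=> a aq; apply: sl; rewrite inE aq orbT.
have [|||a al a1] := @triangular_far C l p q tl.
- by apply: sl; rewrite inE eqxx.
- by apply: sl; rewrite !inE eqxx orbT.
- by apply: contraTneq us => ->; rewrite /= inE eqxx.
have := sign_mean_nrm_ge_coef S 0 al; rewrite a1 size_map => /le_trans; apply.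
by apply: sign_mean_le => b; rewrite add0r signedB.
Qed.

Lemma sign_mean_signed4 (B : R) l p : (forall x, List.In x l -> nrm (x.1 p) <= B) ->
  sign_mean (size l) (fun b => nrm (signed l b p) ^+ 4) <=
  3 * (size l)%:R ^+ 2 * B ^+ 4.
Proof.
move=> lB; have := @sign_mean_nrm4_le R K S B [seq x.1 p | x <- l] 0.
rewrite size_map nrm0 !expr0n !(mulr0, mul0r) !add0r => H.
apply: le_trans (H _); last first.
  move=> a; elim: l lB {H} => [//|x l IH] lB /=; rewrite inE => /orP[/eqP ->|al].
    by apply: lB; left.
  by apply: IH al => y yl; apply: lB; right.
by apply: sign_mean_le => b; rewrite add0r.
Qed.

Lemma signed_close (D : R) l b p q : 0 <= D ->
  (forall x, List.In x l -> nrm (x.1 p - x.1 q) <= D) ->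
  nrm (signed l b p - signed l b q) <= (size l)%:R * D.
Proof.
rewrite signedB; elim: l b => [|x l IH] [|e b] D0 lD /=; rewrite ?nrm0 ?mul0r ?mulr_ge0//.
rewrite -natr1 mulrDl mul1r addrC (le_trans (nrmD _ _ _))// lerD//.
  by apply: IH => // y yl; apply: lD; right.
by case: e; rewrite ?nrmN; apply: lD; left.
Qed.

Variables (N : set (P -> K)) (C : R).
Hypothesis N0 : N (fun=> 0).
Hypothesis NL : forall k g h, N g -> N h -> N (fun p => k * g p + h p).
(** The supremum of [h] enters through a single point. In the applications this is, for nonzero [h],
    a point where [|h|] is at least half its supremum, and the factor 2 goes into [C]. *)
Hypothesis NC : forall h, N h ->
  exists p, forall s, sorted <%O s -> variation h s <= C * nrm (h p).

Lemma N_signed l b : (forall x, List.In x l -> N x.1) -> N (signed l b).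
Proof.
elim: l b => [|x l IH] [|e b] lN; rewrite /signed //=.
have {}IH : N (signed l b) by apply: IH => y yl; apply: lN; right.
have Nx : N x.1 by apply: lN; left.
have := NL (if e then 1 else -1) Nx IH.
congr N; apply/funext => p; case: e; rewrite ?mul1r ?mulN1r//.
Qed.

Lemma triangular_exists : 0 <= C ->
  (forall s, exists2 h, N h & (forall p, p \in s -> h p = 0) /\ exists p, h p <> 0) ->
  forall n, exists l, [/\ size l = n, triangular C l & forall x, List.In x l -> N x.1].
Proof.
move=> C0 H; elim=> [|n [l [ln tl lN]]]; first by exists [::].
have [h Nh [hl [p hp]]] := H (map snd l).
(* Normalizing at the point supplied by [NC], rather than at [p], brings the variation down to [C].
   If [h] vanished at [t] its variation would be 0, so [h] would be constant and zero. *)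
have [t ht] := NC Nh.
have ht0 : h t <> 0.
  move=> h0; have : nrm (h p - h t) <= 0.
    by apply: variation_far => s /ht; rewrite h0 nrm0 mulr0.
  by rewrite h0 subr0 => /(lt_le_trans (nrm_gt0 S hp)); rewrite ltxx.
exists ((fun p => (h t)^-1 * h p, t) :: l); split => /=; first by rewrite ln.
  split => //; first by rewrite mulVf//; exact/eqP.
    by move=> q /hl ->; rewrite mulr0.
  move=> s /ht hs; rewrite variationZ nrmV mulrC ler_pdivrMr//.
  exact: nrm_gt0.
move=> x [<-|/lN//] /=.
by have := NL (h t)^-1 Nh N0; congr N; apply/funext => q; rewrite addr0.
Qed.

Lemma triangular_bound l : triangular C l ->
  forall x, List.In x l -> forall p, nrm (x.1 p) <= C + 1.
Proof.
elim: l => [//|[g t] l IH] /= [gt _ gC /IH{}IH] x [<-|/IH//] p /=.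
rewrite -[g p](subrK (g t)) (le_trans (nrmD _ _ _))// gt nrm1 lerD2r -gt.
exact: variation_far.
Qed.

(* Fix a triangular system of [n] functions. For random signs the mean
   variation of the signed sum is at least [n - 1], because the increment
   between two of the chosen points has a coefficient of modulus 1. On the other
   hand the supremum of the signed sum is controlled by its values on a net of
   [O(n)] points, where its mean fourth power is [O(n^2)]; so the supremum is
   [O(n^(3/4))] up to a small multiple of [n]. *)
Lemma finite_dim_of_variation_le_sup_ge1 : 1 <= C ->
  exists s, forall h, N h -> (forall p, p \in s -> h p = 0) -> forall p, h p = 0.
Proof.
move=> C1; apply: contrapT => nos.
have C0 : 0 < C by lra.
have {nos} H s : exists2 h, N h & (forall p, p \in s -> h p = 0) /\ exists p, h p <> 0.
  apply: contrapT => nh; apply: nos; exists s => h Nh hs p.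
  by apply: contrapT => hp; apply: nh; exists h => //; split=> //; exists p.
(* [B] bounds the functions of a triangular system. [D0] is the product of constants left by the
   fourth-moment term at the end, where the estimate reads [N' <= 1 + N' / 4 + D0]; [n] is chosen to
   contradict it. *)
pose B := C + 1; pose D0 := 24 ^+ 3 * C ^+ 6 * B ^+ 4.
have B0 : 0 <= B by rewrite /B; lra.
have D00 : 0 <= D0.
  apply: mulr_ge0; last exact: exprn_ge0.
  by apply: mulr_ge0; apply: exprn_ge0 => //; exact: ltW.
pose n := (Num.truncn (4 * D0 + 4)).+1.
have nD0 : 4 * D0 + 4 < n%:R by rewrite truncnS_gt.
have [l [ln tl lN]] := triangular_exists (ltW C0) H n.
have lvar := triangular_variation tl.
(* Passing to the net changes a signed sum by at most [N' * D], which after multiplication by [C]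
   costs [N' / 8]. *)
pose D := (8 * C)^-1.
have DC : D * C = 8^-1 by rewrite /D invfM mulrVK ?unitfE ?gt_eqF.
have Dgt0 : 0 < D by rewrite invr_gt0; lra.
have [s [sD snet]] := finite_net Dgt0 (ltW C0) lvar.
rewrite size_map ln in sD.
set N' : R := n%:R in nD0 sD.
have N0' : 0 < N' by lra.
(* A truncation level and its inverse: values below [la] cost only [C * la = N' / 8], and a value
   [x] above it satisfies [x <= w^3 x^4], which the fourth moment controls. *)
pose la := N' / (8 * C); pose w := 8 * C / N'.
have law : la * w = 1 by rewrite /la /w mulrA divfK ?mulfV// gt_eqF//; lra.
have Nw : N' * w = 8 * C by rewrite /w mulrCA mulfV ?mulr1// gt_eqF.
have Cla : C * la = N' / 8.
  by rewrite /la invfM mulrCA [C * _]mulrC mulfVK ?gt_eqF// .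
have la0 : 0 < la by rewrite divr_gt0//; lra.
have w0 : 0 < w by rewrite divr_gt0//; lra.
have quart x : 0 <= x -> x <= la + w ^+ 3 * x ^+ 4.
  move=> x0; have [xla|lax] := leP x la.
    by rewrite (le_trans xla)// lerDl mulr_ge0// exprn_ge0// ltW.
  suff : x <= w ^+ 3 * x ^+ 4 by lra.
  have wx : 1 <= w * x by rewrite -law mulrC ler_pM2l// ltW.
  have -> : w ^+ 3 * x ^+ 4 = (w * x) ^+ 3 * x by ring.
  by rewrite ler_peMl// exprn_ege1.
pose t := sort <=%O (map snd l).
have tlt : sorted <%O t by rewrite sort_lt_sorted; exact: triangular_uniq tl.
have Hlow : N' <= 1 + sign_mean (size l) (fun b => variation (signed l b) t).
  have := @sign_mean_variation C l t tl.
  rewrite /t sort_uniq size_sort size_map ln; apply.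
    exact: triangular_uniq tl.
  by move=> p; rewrite mem_sort.
have Hup b : variation (signed l b) t <=
    C * (la + N' * D) + C * w ^+ 3 * \sum_(q <- s) nrm (signed l b q) ^+ 4.
  have [p0 hp0] := NC (N_signed b lN).
  apply: (le_trans (hp0 t tlt)).
  rewrite -mulrA -mulrDr ler_pM2l//.
  have [q qs pq] := snet p0.
  have h1 : nrm (signed l b p0 - signed l b q) <= N' * D.
    rewrite /N' -ln; apply: signed_close => [|x xl]; first exact: ltW.
    by apply: pq; exact: List.in_map xl.
  have h2 : nrm (signed l b p0) <= nrm (signed l b p0 - signed l b q) + nrm (signed l b q).
    by rewrite -{1}[signed l b p0](subrK (signed l b q)) nrmD.
  have h3 := quart _ (nrm_ge0 S (signed l b q)).
  (* The net point [q] depends on the signs [b]; summing over the whole net removes this dependence,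
     so that the mean can be taken term by term. *)
  have h4 : nrm (signed l b q) ^+ 4 <= \sum_(q <- s) nrm (signed l b q) ^+ 4.
    by rewrite (big_rem q)//= lerDl sumr_ge0// => i _; rewrite exprn_ge0// nrm_ge0.
  have h5 : w ^+ 3 * nrm (signed l b q) ^+ 4 <=
      w ^+ 3 * \sum_(q <- s) nrm (signed l b q) ^+ 4.
    by rewrite ler_wpM2l// exprn_ge0// ltW.
  lra.
have := sign_mean_le (size l) Hup.
rewrite sign_meanD sign_mean_cst sign_meanZ sign_mean_sum.
have H4 : \sum_(q <- s) sign_mean (size l) (fun b => nrm (signed l b q) ^+ 4) <=
    (size s)%:R * (3 * N' ^+ 2 * B ^+ 4).
  elim: s {sD snet Hup} => [|q s IH]; first by rewrite big_nil mul0r.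
  rewrite big_cons /= -natr1 mulrDl mul1r addrC lerD//.
  by rewrite /N' -ln; apply: sign_mean_signed4 => x xl; exact: triangular_bound tl _ xl q.
have Cw0 : 0 <= C * w ^+ 3 by rewrite mulr_ge0 ?exprn_ge0// ltW.
move: (ler_wpM2l Cw0 H4).
set m : R := (size s)%:R in sD *.
have m9 : m <= 9 * N' * C ^+ 2.
  have : 8 * C * (D * m) <= 8 * C * (D + N' * C) by rewrite ler_pM2l//; lra.
  have -> : 8 * C * (D * m) = m by rewrite mulrA -(mulrA 8) (mulrC C) DC divff ?mul1r.
  have -> : 8 * C * (D + N' * C) = 1 + 8 * N' * C ^+ 2.
    by rewrite mulrDr -(mulrA 8) (mulrC C) DC divff// expr2; ring.
  have : 1 <= N' * C ^+ 2 by rewrite mulr_ege1// ?exprn_ege1//; lra.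
  lra.
have -> : C * w ^+ 3 * (m * (3 * N' ^+ 2 * B ^+ 4)) =
    3 * C * B ^+ 4 * (N' * w) ^+ 2 * (w * m) by ring.
have wm : w * m <= 72 * C ^+ 3.
  apply: (@le_trans _ _ (w * (9 * N' * C ^+ 2))); first by have w0' := ltW w0; apply: ler_wpM2l.
  have -> : w * (9 * N' * C ^+ 2) = 9 * (N' * w) * C ^+ 2 by ring.
  by rewrite Nw; have -> : 9 * (8 * C) * C ^+ 2 = 72 * C ^+ 3 by ring.
rewrite Nw.
have X0 : 0 <= 3 * C * B ^+ 4 * (8 * C) ^+ 2.
  have c0 := ltW C0; apply: mulr_ge0; last by apply/exprn_ge0/mulr_ge0.
  by apply: mulr_ge0; [exact: mulr_ge0|exact: exprn_ge0].
have := ler_wpM2l X0 wm.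
have -> : 3 * C * B ^+ 4 * (8 * C) ^+ 2 * (72 * C ^+ 3) = D0 by rewrite /D0; ring.
have -> : C * (la + N' * D) = N' / 8 + N' / 8.
  have e : C * (N' * D) = N' / 8 by rewrite -DC; ring.
  by rewrite -{1}Cla -e; ring.
lra.
Qed.

End BoundedVariation.

Lemma finite_dim_of_variation_le_sup (R : realType) (K : numFieldType)
    (S : scalars R K) (d : Order.disp_t) (P : orderType d)
    (N : set (P -> K)) (C : R) :
  N (fun=> 0) -> (forall k g h, N g -> N h -> N (fun p => k * g p + h p)) ->
  (forall h, N h -> exists p, forall s, sorted <%O s ->
     variation S h s <= C * nrm S (h p)) ->
  exists s : seq P, forall h, N h -> (forall p, p \in s -> h p = 0) ->
    forall p, h p = 0.
Proof.
move=> N0 NL NC.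
apply: (@finite_dim_of_variation_le_sup_ge1 _ _ S _ _ N (`|C| + 1)) => //; last first.
  by rewrite lerDr.
move=> h /NC[p hp]; exists p => s /hp /le_trans; apply.
by rewrite ler_wpM2r ?nrm_ge0//; have := ler_norm C; lra.
Qed.

(** * Linear spans *)

Definition linear_set (K : numFieldType) (E : lmodType K) (M : set E) : Prop :=
  M 0 /\ forall k x y, M x -> M y -> M (k *: x + y).

Section LinearSets.
Context (K : numFieldType).
Implicit Types E F : lmodType K.

Lemma linear_setD E (M : set E) x y : linear_set M -> M x -> M y -> M (x + y).
Proof. by move=> [_ L] Mx My; rewrite -[x]scale1r; exact: L. Qed.

Lemma linear_setZ E (M : set E) k x : linear_set M -> M x -> M (k *: x).
Proof. by move=> [M0 L] Mx; rewrite -[k *: x]addr0; exact: L. Qed.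

Lemma linear_setB E (M : set E) x y : linear_set M -> M x -> M y -> M (x - y).
Proof.
by move=> L Mx My; rewrite -[- y]scaleN1r; apply: linear_setD => //; exact: linear_setZ.
Qed.

Lemma linear_set_sum E (M : set E) n (f : 'I_n -> E) : linear_set M ->
  (forall i, M (f i)) -> M (\sum_(i < n) f i).
Proof.
by move=> L Mf; elim/big_ind: _ => // [|x y]; [exact: L.1|exact: linear_setD].
Qed.

Lemma linear_set_range E F (f : {linear E -> F}) : linear_set (range f).
Proof.
split; first by exists 0; rewrite ?linear0.
by move=> k _ _ [x _ <-] [y _ <-]; exists (k *: x + y) => //; rewrite linearP.
Qed.

End LinearSets.

Section LinSpan.
Context (K : numFieldType) (E : normedModType K).
Implicit Types (A M : set E) (s : seq E).

Lemma lin_span_linear A : linear_set (lin_span A).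
Proof.
split; first by exists 0, (fun=> 0), (fun=> 0); split=> [[]//|]; rewrite big_ord0.
move=> k _ _ [n [a [v [Av ->]]]] [m [b [w [Aw ->]]]].
exists (n + m)%N,
  (fun i : 'I_(n + m) => match fintype.split i with inl j => k * a j | inr j => b j end),
  (fun i : 'I_(n + m) => match fintype.split i with inl j => v j | inr j => w j end); split.
  by move=> i; case: fintype.split.
rewrite big_split_ord /= scaler_sumr; congr (_ + _); apply: eq_bigr => i _.
  by rewrite (unsplitK (inl i)) scalerA.
by rewrite (unsplitK (inr i)).
Qed.

Lemma sub_lin_span A : A `<=` lin_span A.
Proof.
by move=> x Ax; exists 1%N, (fun=> 1), (fun=> x); rewrite big_ord1 scale1r.
Qed.

Lemma lin_span_min A M : linear_set M -> A `<=` M -> lin_span A `<=` M.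
Proof.
move=> LM AM x [n [a [v [Av ->]]]]; apply: linear_set_sum => // i.
by apply: linear_setZ => //; exact/AM.
Qed.

Lemma lin_spanS A B : A `<=` B -> lin_span A `<=` lin_span B.
Proof.
move=> AB; apply: lin_span_min; first exact: lin_span_linear.
by move=> x /AB; exact: sub_lin_span.
Qed.

(** Induction on the separating list: the kernel of one functional in [M] is separated by the rest,
    and a single vector outside it restores [M]. *)
Lemma finite_span_of_functionals (T : Type) (f : T -> E -> K) (s : seq T) M :
  (forall t k x y, f t (k *: x + y) = k * f t x + f t y) -> linear_set M ->
  (forall x, M x -> (forall t, List.In t s -> f t x = 0) -> x = 0) ->
  exists2 A : set E, finite_set A & M = lin_span A.
Proof.
move=> fl; elim: s M => [|t s IH] M LM Ms.
  exists set0; first exact: finite_set0.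
  apply/seteqP; split=> [x /Ms -> //|]; first exact: (lin_span_linear set0).1.
  exact: lin_span_min.
have [[v Mv fv]|nv] := pselect (exists2 v, M v & f t v <> 0); last first.
  apply: IH => // x Mx xs; apply: Ms => // t' [<-|/xs//].
  by apply: contrapT => fx; apply: nv; exists x.
have f0 : f t 0 = 0.
  by have := fl t (-1) 0 0; rewrite scaleN1r oppr0 addr0 mulN1r addNr.
pose M' := M `&` [set x | f t x = 0].
have LM' : linear_set M'.
  split; first by split; [exact: LM.1|].
  move=> k x y [Mx fx] [My fy]; split; first exact: LM.2.
  by rewrite /= fl fx fy mulr0 addr0.
have [|A fA M'A] := IH M' LM'.
  by move=> x [Mx fx] xs; apply: Ms => // t' [<-|/xs].
exists (v |` A); first by rewrite finite_setU; split.
have AM : A `<=` M by move=> x /sub_lin_span; rewrite -M'A => -[].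
apply/seteqP; split=> [x Mx|]; last by apply: lin_span_min => // x [->//|/AM].
pose c := f t x / f t v.
have : lin_span A (- c *: v + x).
  rewrite -M'A; split; first exact: LM.2.
  by rewrite /= fl mulNr divfK ?addNr//; exact/eqP.
move=> /(lin_spanS (@subsetUr _ [set v] A)) h.
rewrite (_ : x = c *: v + (- c *: v + x)); last by rewrite addrA -scalerDl subrr scale0r add0r.
by apply: (lin_span_linear _).2 => //; apply: sub_lin_span; left.
Qed.

(** Each spanning vector [v] costs at most one new index: either some [y] congruent to [v] modulo
    the old span is killed by the old indices but detected by [t0], which is then added, or the old
    indices still suffice. *)
Lemma functionals_of_finite_span (T : Type) (f : T -> E -> K) A :
  (forall t k x y, f t (k *: x + y) = k * f t x + f t y) -> finite_set A ->
  exists s : seq T, forall x, lin_span A x -> (forall t, List.In t s -> f t x = 0) ->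
    forall t, f t x = 0.
Proof.
move=> fl /finite_seqP[l ->]; elim: l => [|v l [s IH]].
  exists [::] => x h _ t.
  have : [set 0] x.
    by apply: lin_span_min h => //; split=> //= k _ _ -> ->; rewrite scaler0 addr0.
  by move=> ->; have := fl t (-1) 0 0; rewrite scaleN1r oppr0 addr0 mulN1r addNr.
have dec x : lin_span [set` v :: l] x -> exists k, lin_span [set` l] (k *: v + x).
  move=> xl; suff : [set x | exists k, lin_span [set` l] (k *: v + x)] x by [].
  apply: lin_span_min xl; first split.
  - by exists 0; rewrite scale0r addr0; exact: (lin_span_linear _).1.
  - move=> k a b [ka ha] [kb hb]; exists (k * ka + kb).
    have -> : (k * ka + kb) *: v + (k *: a + b) = k *: (ka *: v + a) + (kb *: v + b).
      by rewrite scalerDr scalerA scalerDl addrACA.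
    exact: (lin_span_linear _).2.
  - move=> y /=; rewrite inE => /orP[/eqP ->|yl].
      by exists (-1); rewrite scaleN1r addNr; exact: (lin_span_linear _).1.
    by exists 0; rewrite scale0r add0r; exact: sub_lin_span.
have fD t x y : f t (x + y) = f t x + f t y by rewrite -{1}[x]scale1r fl mul1r.
have f0 t : f t 0 = 0.
  by have := fl t (-1) 0 0; rewrite scaleN1r oppr0 addr0 mulN1r addNr.
have fZ t k x : f t (k *: x) = k * f t x by rewrite -[k *: x]addr0 fl f0 addr0.
have [[y hy [ys [t0 fy]]]|no] := pselect (exists2 y, lin_span [set` l] (y - v) &
    (forall t, List.In t s -> f t y = 0) /\ exists t, f t y <> 0); last first.
  exists s => x xl xs; have [k hk] := dec x xl.
  have [k0|k0] := eqVneq k 0; first by apply: IH => //; move: hk; rewrite k0 scale0r add0r.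
  pose y := - k^-1 *: x.
  have hy : lin_span [set` l] (y - v).
    have -> : y - v = - k^-1 *: (k *: v + x).
      by rewrite scalerDr scalerA mulNr mulVf// scaleN1r addrC.
    by apply: linear_setZ hk; exact: lin_span_linear.
  move=> t; apply: contrapT => fx; apply: no; exists y => //; split.
    by move=> t' /xs; rewrite /y fZ => ->; rewrite mulr0.
  exists t; rewrite /y fZ => /eqP; rewrite mulf_eq0 oppr_eq0 invr_eq0 (negPf k0) /=.
  exact/negP/eqP.
exists (t0 :: s) => x xl xs t; have [k hk] := dec x xl.
have hz : lin_span [set` l] (k *: y + x).
  have -> : k *: y + x = k *: (y - v) + (k *: v + x) by rewrite addrA -scalerDr subrK.
  exact: (lin_span_linear _).2.
have z0 : forall t, f t (k *: y + x) = 0.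
  by apply: IH hz _ => t' ts; rewrite fl ys// xs ?mulr0 ?addr0//; right.
have := z0 t0; rewrite fl (xs t0) ?addr0; last by left.
move=> /eqP; rewrite mulf_eq0 => /orP[/eqP k0|/eqP//].
by have := z0 t; rewrite k0 scale0r add0r.
Qed.

End LinSpan.

(** * The Hahn-Banach theorem *)

Section HahnBanach.
Context (R : realType) (K : numFieldType) (S : scalars R K) (E : lmodType K).
Local Notation rl := (rl S).
Local Notation re := (re S).
Local Notation nrm := (nrm S).
Local Notation iu := (iu S).
Variable p : E -> R.
Hypothesis pD : forall x y, p (x + y) <= p x + p y.
Hypothesis pZ : forall k x, p (k *: x) = nrm k * p x.

Let pr c x : p (rl c *: x) = `|c| * p x.
Proof. by rewrite pZ nrm_rl. Qed.

Let p0 : p 0 = 0.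
Proof. by rewrite -(scale0r 0) pZ nrm0 mul0r. Qed.

(** Partial real-linear functionals are handled as graphs, so that the union of a chain is a union
    of sets; domination by [p] makes such a graph single-valued. *)
Definition dominated_graph (G : set (E * R)) : Prop :=
  [/\ G (0, 0),
    forall c x a y b, G (x, a) -> G (y, b) -> G (rl c *: x + y, c * a + b) &
    forall x a, G (x, a) -> a <= p x].

Lemma dominated_graph_unique G x a b :
  dominated_graph G -> G (x, a) -> G (x, b) -> a = b.
Proof.
move=> [_ GL Gp]; suff le u v : G (x, u) -> G (x, v) -> u <= v.
  by move=> Ga Gb; apply/eqP; rewrite eq_le !le.
move=> Gu Gv; have := GL (-1) _ _ _ _ Gv Gu.
by rewrite rmorphN1 scaleN1r addNr => /Gp; rewrite p0; lra.
Qed.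

Lemma dominated_graph_step G x0 : dominated_graph G ->
  exists r : R, dominated_graph
    [set u | exists c x a, G (x, a) /\ u = (x + rl c *: x0, a + c * r)].
Proof.
move=> [G0 GL Gp].
have GD x a y b : G (x, a) -> G (y, b) -> G (x + y, a + b).
  by move=> Ga Gb; have := GL 1 _ _ _ _ Ga Gb; rewrite rmorph1 scale1r mul1r.
have GZ c x a : G (x, a) -> G (rl c *: x, c * a).
  by move=> Ga; have := GL c _ _ _ _ Ga G0; rewrite !addr0.
(* The value [r] at [x0] must lie above every element of [L] and below every [p (y + x0) - b];
   subadditivity puts the former below the latter, and [r = sup L] works. *)
pose L := [set s | exists x a, G (x, a) /\ s = a - p (x - x0)].
have Lub y b : G (y, b) -> ubound L (p (y + x0) - b).
  move=> Gb _ [x [a [Ga ->]]].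
  have := Gp _ _ (GD _ _ _ _ Ga Gb).
  have := pD (x - x0) (y + x0); rewrite addrACA addNr addr0; lra.
have L0 : L !=set0 by exists (0 - p (0 - x0)), 0, 0.
have hs : has_sup L by split=> //; exists (p (0 + x0) - 0); exact: Lub.
pose r := sup L.
have r1 x a : G (x, a) -> a - r <= p (x - x0).
  move=> Ga; have : L (a - p (x - x0)) by exists x, a.
  by move=> /(sup_upper_bound hs); rewrite -/r; lra.
have r2 y b : G (y, b) -> b + r <= p (y + x0).
  by move=> /Lub /(ge_sup L0); rewrite -/r; lra.
exists r; split.
- by exists 0, 0, 0; rewrite rmorph0 scale0r mul0r !addr0.
- move=> c _ _ _ _ [c1 [x1 [a1 [G1 [-> ->]]]]] [c2 [x2 [a2 [G2 [-> ->]]]]].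
  exists (c * c1 + c2), (rl c *: x1 + x2), (c * a1 + a2); split; first exact: GL.
  congr pair; last by ring.
  by rewrite scalerDr scalerA -rmorphM addrACA -scalerDl -rmorphD.
move=> _ _ [c [x [a [Ga [-> ->]]]]].
have [c0|c0|->] := ltgtP c 0; last by rewrite rmorph0 scale0r mul0r !addr0; exact: Gp.
  have := r1 _ _ (GZ (- c)^-1 _ _ Ga).
  have c0' : 0 < - c by lra.
  rewrite -(ler_pM2l c0') mulrBr mulVKf ?gt_eqF// -{2}(gtr0_norm c0') -pr.
  rewrite scalerBr scalerA -rmorphM mulfV ?gt_eqF// rmorph1 scale1r rmorphN scaleNr opprK.
  by rewrite mulNr opprK.
have := r2 _ _ (GZ c^-1 _ _ Ga).
rewrite -(ler_pM2l c0) mulrDr mulVKf ?gt_eqF// -{2}(gtr0_norm c0) -pr.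
by rewrite scalerDr scalerA -rmorphM mulfV ?gt_eqF// rmorph1 scale1r.
Qed.

Lemma dominated_graph_total G0 : dominated_graph G0 ->
  exists2 G, dominated_graph G & G0 `<=` G /\ forall x, exists a, G (x, a).
Proof.
move=> G0d.
(* Zorn's lemma is applied to the part added to [G0], so that the empty chain has an admissible
   union too. *)
have [F FP Ftot|A [AP Amax]] := @Zorn_bigcup _ [set X | dominated_graph (G0 `|` X)].
  have two u v : (G0 `|` \bigcup_(X in F) X) u -> (G0 `|` \bigcup_(X in F) X) v ->
      exists G, [/\ dominated_graph G, G u, G v & G `<=` G0 `|` \bigcup_(X in F) X].
    have FG X : F X -> G0 `|` X `<=` G0 `|` \bigcup_(X in F) X.
      by move=> FX; apply: setUS; exact: bigcup_sup.
    move=> [u0|[X FX Xu]] [v0|[Y FY Yv]].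
    - by exists G0; split=> //; exact: subsetUl.
    - by exists (G0 `|` Y); split; [exact: FP|left|right|exact: FG].
    - by exists (G0 `|` X); split; [exact: FP|right|left|exact: FG].
    have [XY|YX] := Ftot _ _ FX FY.
      by exists (G0 `|` Y); split; [exact: FP|right; exact: XY|right|exact: FG].
    by exists (G0 `|` X); split; [exact: FP|right|right; exact: YX|exact: FG].
  split; first by left; case: G0d.
    move=> c x a y b Ga Gb; have [G [[_ GL _] Gu Gv sG]] := two _ _ Ga Gb.
    exact/sG/GL.
  by move=> x a Ga; have [G [[_ _ Gp] /Gp]] := two _ _ Ga Ga.
exists (G0 `|` A) => //; split=> [|x0]; first exact: subsetUl.
apply: contrapT => nx0.
have [r Gr] := dominated_graph_step x0 AP.
set B := [set u | _] in Gr.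
have AB : G0 `|` A `<=` B.
  by move=> [x a] Ga; exists 0, x, a; rewrite rmorph0 scale0r mul0r !addr0.
have [AP0 _ _] := AP.
have Bx0 : B (x0, r) by exists 1, 0, 0; rewrite rmorph1 scale1r mul1r !add0r.
apply: (Amax B); last first.
  by rewrite /= setUidr//; apply: subset_trans AB; exact: subsetUl.
rewrite properEneq; split; last by apply: subset_trans AB; exact: subsetUr.
by apply/eqP => AeB; apply: nx0; exists r; right; rewrite AeB.
Qed.

(** The real part is extended and then complexified as [F x = u x - iu * u (iu x)]. Estimating the
    two terms separately costs the factor 2. The applications only use that [F] is bounded and
    vanishes where [p] does. *)
Lemma hahn_banach (Z : set E) (f : E -> K) : linear_set Z ->
  (forall k x y, Z x -> Z y -> f (k *: x + y) = k * f x + f y) ->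
  (forall z, Z z -> nrm (f z) <= p z) ->
  exists F : E -> K, [/\ forall k x y, F (k *: x + y) = k * F x + F y,
    forall z, Z z -> F z = f z & forall x, nrm (F x) <= 2 * p x].
Proof.
move=> LZ fL fp.
have f0 : f 0 = 0.
  by have := fL (-1) 0 0 LZ.1 LZ.1; rewrite scaleN1r oppr0 addr0 mulN1r addNr.
have fZ k z : Z z -> f (k *: z) = k * f z.
  by move=> Zz; have := fL k z 0 Zz LZ.1; rewrite !addr0 f0 addr0.
have [|G Gd [G0G Gtot]] := @dominated_graph_total
    [set u | Z u.1 /\ u.2 = re (f u.1)].
  split.
  - by split; [exact: LZ.1|rewrite /= f0 re0].
  - move=> c x a y b [/= Zx ->] [/= Zy ->]; split; first exact: LZ.2.
    by rewrite /= fL// reD reZ.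
  - move=> x a [/= Zx ->]; apply: le_trans (fp _ Zx).
    exact: le_trans (ler_norm _) (re_le S _).
have [u Gu] := choice Gtot.
have [G0 GL Gp] := Gd.
have uL c x y : u (rl c *: x + y) = c * u x + u y.
  by apply: (dominated_graph_unique Gd (Gu _)); exact: GL.
have uD x y : u (x + y) = u x + u y.
  by have := uL 1 x y; rewrite rmorph1 scale1r mul1r.
have u0 : u 0 = 0 by apply: (dominated_graph_unique Gd (Gu _)).
have uZ c x : u (rl c *: x) = c * u x by rewrite -[rl c *: x]addr0 uL u0 addr0.
have uN x : u (- x) = - u x by rewrite -scaleN1r -(rmorphN1 rl) uZ mulN1r.
have uf z : Z z -> u z = re (f z).
  by move=> Zz; apply: (dominated_graph_unique Gd (Gu _)); apply: G0G.
have ub x : `|u x| <= p x.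
  rewrite ler_norml (Gp _ _ (Gu x)) andbT lerNl -uN.
  rewrite (le_trans (Gp _ _ (Gu _)))// -scaleN1r pZ nrmN nrm1 mul1r//.
pose F x := rl (u x) - iu * rl (u (iu *: x)).
have FD x y : F (x + y) = F x + F y.
  by rewrite /F scalerDr !uD !rmorphD mulrDr; ring.
have Frl c x : F (rl c *: x) = rl c * F x.
  have e : iu *: (rl c *: x) = rl c *: (iu *: x) by rewrite !scalerA mulrC.
  by rewrite /F e !uZ !rmorphM; ring.
have Fiu x : F (iu *: x) = iu * F x.
  rewrite /F scalerA; have [i0|i2] := iu2 S.
    by rewrite i0 scale0r u0 rmorph0 !mul0r subrr.
  by rewrite i2 scaleN1r uN rmorphN mulrBr mulrA i2 mulrN mulN1r !opprK addrC.
have FZ k x : F (k *: x) = k * F x.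
  rewrite [k in LHS](reE S) [k in RHS](reE S) scalerBl FD -scaleN1r.
  rewrite -(rmorphN1 rl) !Frl -scalerA Fiu Frl rmorphN1; ring.
exists F; split=> [k x y|z Zz|x].
- by rewrite FD FZ.
- rewrite /F !uf ?fZ -?reE//; exact: linear_setZ.
rewrite /F (le_trans (nrmD _ _ _))// nrmN nrmM !nrm_rl mulr2n mulrDl mul1r lerD//.
have : `|u (iu *: x)| <= nrm iu * p x by rewrite -pZ.
have := nrm_iu S; have := nrm_ge0 S iu; have := ub x; have := normr_ge0 (u x).
have := normr_ge0 (u (iu *: x)); nra.
Qed.

End HahnBanach.

(** * Weak topologies *)

Section Operators.
Context (R : realType) (K : numFieldType) (S : scalars R K).
Local Notation nrm := (nrm S).
Local Notation nv := (nv S).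
Implicit Types E F : normedModType K.

Lemma operator_bound E F (T : operator E F) :
  exists2 M : R, 0 < M & forall x, nv (T x) <= M * nv x.
Proof.
have [M TM] := op_bounded T; exists (nrm M + 1).
  by have := nrm_ge0 S M; lra.
move=> x; have : `|T x| <= `| M * `|x| |.
  by rewrite (ger0_norm (le_trans (normr_ge0 _) (TM x))).
rewrite normrM normr_id (nrmE S M) !(nvE S) -rmorphM rl_le => /le_trans; apply.
by rewrite ler_wpM2r ?nv_ge0//; lra.
Qed.

Lemma operator_of E F (f : E -> F) (M : R) :
  (forall k x y, f (k *: x + y) = k *: f x + f y) ->
  (forall x, nv (f x) <= M * nv x) -> exists T : operator E F, f = T.
Proof.
move=> fl fM; have fl' : linear f := fl.
pose g : {linear E -> F} := HB.pack f (GRing.isLinear.Build _ _ _ _ _ fl').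
have gM : exists M : K, forall x, `|g x| <= M * `|x|.
  by exists (rl S M) => x; rewrite !(nvE S) -rmorphM rl_le; exact: fM.
by exists (Operator gM).
Qed.

Lemma functional_of E (f : E -> K) (M : R) :
  (forall k x y, f (k *: x + y) = k * f x + f y) ->
  (forall x, nrm (f x) <= M * nv x) -> exists T : dual_space E, f = T.
Proof.
move=> fl fM; apply: (@operator_of E K^o f M) => // x.
by rewrite nv_K.
Qed.

Lemma functional_bound E (f : dual_space E) :
  exists2 M : R, 0 < M & forall x, nrm (f x) <= M * nv x.
Proof.
by have [M M0 fM] := operator_bound f; exists M => // x; rewrite -nv_K.
Qed.

Lemma functionalP E (f : dual_space E) k x y :
  f (k *: x + y) = k * f x + f y :> K.
Proof. exact: linearP. Qed.

End Operators.

Section WeakTopology.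
Context (R : realType) (K : numFieldType) (S : scalars R K).
Local Notation nrm := (nrm S).
Local Notation nv := (nv S).
Implicit Types E F : normedModType K.

Lemma cvg_initial (X : choiceType) (T : topologicalType) (f : X -> T)
    (F : set_system X) (x : X) : Filter F ->
  F --> (x : initial_topology f) <-> f @ F --> f x.
Proof.
move=> FF; split=> [Fx A /(@initial_continuous _ _ f x) fA|fFx A].
  exact: Fx.
move=> [_ [[B oB <-] Bx BA]]; apply: filterS BA _.
by apply: fFx; exact: open_nbhs_nbhs.
Qed.

Lemma weak_cvgP E (X : Type) (G : set_system X) (u : X -> E) (l : E) : Filter G ->
  (u : X -> weak E) @ G --> (l : weak E) <->
  forall (f : dual_space E) (e : R), 0 < e -> G [set t | nrm (f l - f (u t)) < e].
Proof.
move=> FG; rewrite cvg_sup; split=> H f.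
  move=> e e0.
  have /cvg_initial/(nv_cvg S)/(_ e e0) : (u : X -> weak E) @ G -->
    (l : initial_topology (f : E -> K^o)) := H f.
  move=> h; suff : G [set t | nv (f l - f (u t)) < e].
    by apply: filterS => t /=; rewrite nv_K.
  exact: h.
have : (u : X -> weak E) @ G --> (l : initial_topology (f : E -> K^o)).
  apply/cvg_initial/(nv_cvg S) => e e0.
  suff : G [set t | nv (f l - f (u t)) < e] by [].
  by apply: filterS (H f e e0) => t /=; rewrite nv_K.
exact.
Qed.

Lemma weak_nbhs E (f : dual_space E) (y : E) (e : R) : 0 < e ->
  nbhs (y : weak E) [set x | nrm (f y - f x) < e].
Proof.
have /weak_cvgP := @cvg_id _ (nbhs (y : weak E)) :
  (id : E -> weak E) @ nbhs (y : weak E) --> (y : weak E).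
by move=> /(_ f e).
Qed.

Lemma weak_cluster_eq E (G : set_system E) (y : E) (f : dual_space E) (c : K) :
  Filter G -> cluster (G : set_system (weak E)) (y : weak E) ->
  (forall e : R, 0 < e -> G [set x | nrm (c - f x) < e]) -> f y = c.
Proof.
move=> FG Gy Gc; apply: contrapT => fyc.
have d0 : 0 < nrm (f y - c) by apply: nrm_gt0 => /eqP; rewrite subr_eq0 => /eqP.
have d2 : 0 < nrm (f y - c) / 2 by lra.
have [x [/= cx yx]] := Gy _ _ (Gc _ d2) (weak_nbhs f y d2).
have := nrmD S (f y - f x) (f x - c); rewrite subrKA (nrmB S (f x)); lra.
Qed.

(** The functional [k a -> k p(a)] on the line through [a] is extended under the seminorm [p], the
    distance to [M]; domination by [p] makes the extension vanish on [M]. *)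
Lemma separation E (M : set E) (a : E) (d : R) : linear_set M -> 0 < d ->
  (forall m, M m -> d <= nv (a - m)) ->
  exists f : dual_space E, (forall m, M m -> f m = 0) /\ f a != 0.
Proof.
move=> LM d0 da.
pose D x := [set r | exists2 m, M m & r = nv (x - m)].
pose p x := inf (D x).
have hD x : has_inf (D x).
  split; first by exists (nv (x - 0)), 0; [exact: LM.1|].
  by exists 0 => _ [m _ ->]; exact: nv_ge0.
have pm x m : M m -> p x <= nv (x - m).
  by move=> Mm; apply: ge_inf; [case: (hD x)|exists m].
have pge x r : (forall m, M m -> r <= nv (x - m)) -> r <= p x.
  by move=> h; apply: lb_le_inf; [case: (hD x)|move=> _ [m /h ? ->]].
have pD x y : p (x + y) <= p x + p y.
  have h m : M m -> p (x + y) - nv (x - m) <= p y.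
    move=> Mm; apply: pge => n Mn; rewrite lerBlDr.
    have := pm (x + y) _ (linear_setD LM Mm Mn).
    move=> /le_trans; apply.
    by rewrite (_ : _ - _ = (y - n) + (x - m)) ?nvD// opprD addrACA addrC.
  suff : p (x + y) - p y <= p x by lra.
  by apply: pge => m /h; lra.
have pZle k x : p (k *: x) <= nrm k * p x.
  have [->|k0] := eqVneq k 0.
    rewrite scale0r nrm0 mul0r; apply: le_trans (pm _ _ LM.1) _.
    by rewrite subrr nv0.
  have kp : 0 < nrm k by apply: nrm_gt0; exact/eqP.
  rewrite mulrC -ler_pdivrMr//; apply: pge => m Mm.
  rewrite ler_pdivrMr// mulrC -nvZ scalerBr.
  by apply: pm; exact: linear_setZ.
have pZ k x : p (k *: x) = nrm k * p x.
  apply/eqP; rewrite eq_le pZle /=.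
  have [->|k0] := eqVneq k 0.
    by rewrite nrm0 mul0r; apply: pge => m _; exact: nv_ge0.
  have kp : 0 < nrm k by apply: nrm_gt0; exact/eqP.
  have := pZle k^-1 (k *: x); rewrite scalerA mulVf// scale1r nrmV.
  by rewrite mulrC ler_pdivlMr// mulrC.
have pa : 0 < p a by apply: lt_le_trans d0 _; exact: pge.
have a0 : a != 0.
  apply/eqP => a0; have := da 0 LM.1; rewrite a0 subrr nv0; lra.
pose Z := [set x | exists k, x = k *: a].
have LZ : linear_set Z.
  split; first by exists 0; rewrite scale0r.
  move=> k _ _ [k1 ->] [k2 ->]; exists (k * k1 + k2).
  by rewrite scalerA scalerDl.
pose c x := xget 0 [set k | x = k *: a].
have ca k : c (k *: a) = k.
  have : [set l | k *: a = l *: a] (c (k *: a)) by apply: xgetI; exact: erefl.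
  move=> /= /esym/eqP; rewrite -subr_eq0 -scalerBl scaler_eq0 (negPf a0) orbF.
  by rewrite subr_eq0 => /eqP.
have [|z [k ->]|F [FL Ff Fb]] :=
  @hahn_banach _ _ S _ p pD pZ Z (fun x => c x * rl S (p a)) LZ.
- move=> k _ _ [k1 ->] [k2 ->].
  by rewrite scalerA -scalerDl !ca mulrDl mulrA.
- by rewrite ca nrmM nrm_rl pZ gtr0_norm.
have [|f Ef] := @functional_of _ _ S E F 2 FL.
  move=> x; apply: le_trans (Fb x) _; rewrite ler_pM2l//.
  by have := pm x 0 LM.1; rewrite subr0.
exists f; split=> [m Mm|].
  rewrite -Ef; apply: (@nrm_eq0 _ _ S); apply/eqP; rewrite eq_le nrm_ge0 andbT.
  have := Fb m; have := pm m m Mm; rewrite subrr nv0; lra.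
rewrite -Ef Ff; last by exists 1; rewrite scale1r.
rewrite -[X in c X](scale1r a) ca mul1r -(rmorph0 (rl S)) (inj_eq (@rl_inj _ _ S)).
by rewrite gt_eqF.
Qed.

Lemma closed_separation E (M : set E) (a : E) : linear_set M -> closed M ->
  ~ M a -> exists f : dual_space E, (forall m, M m -> f m = 0) /\ f a != 0.
Proof.
move=> LM cM Ma.
have : nbhs a (~` M) by apply: open_nbhs_nbhs; split=> //; exact: closed_openC.
move=> /(nv_nbhs S)[e e0 eM]; apply: (separation LM e0) => m Mm.
by rewrite leNgt; apply/negP => /eM.
Qed.

End WeakTopology.

(** * The weak topology of a closed subspace *)

Section Subspaces.
Context (R : realType) (K : numFieldType) (S : scalars R K).
Context (E : completeNormedModType K) (Z : closedSubspace E).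
Local Notation nrm := (nrm S).
Local Notation nv := (nv S).

Lemma closedSubspace_linear (F : normedModType K) (M : closedSubspace F) : linear_set (cs_set M).
Proof.
have [M0 ML] := cs_submod M; split; first exact: set_mem M0.
by move=> k x y Mx My; apply: set_mem; apply: ML; exact: mem_set.
Qed.

Lemma subspace_valP (z : subspace_banach Z) : cs_set Z (val z).
Proof. exact: set_mem (valP z). Qed.

Lemma subspace_val_surj x : cs_set Z x -> exists z : subspace_banach Z, val z = x.
Proof. by move=> Zx; exists (SubspaceBanach (mem_set Zx : x \in subspace_pred Z)). Qed.

Lemma subspace_val_linear k (x y : subspace_banach Z) :
  val (k *: x + y) = k *: val x + val y.
Proof. exact: linearP. Qed.

Lemma nv_subspace (z : subspace_banach Z) : nv z = nv (val z).
Proof. by []. Qed.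

Lemma functional_extension (g : dual_space (subspace_banach Z)) :
  exists f : dual_space E, forall z : subspace_banach Z, f (val z) = g z.
Proof.
have [M M0 gM] := functional_bound S g.
pose h x : K := g (insubd (0 : subspace_banach Z) x).
have hE z : h (val z) = g z by rewrite /h valKd.
have [||||F [FL Ff Fb]] := @hahn_banach _ _ S _ (fun x : E => M * nv x) _ _
  (cs_set Z) h (closedSubspace_linear Z).
- by move=> x y; rewrite -mulrDr ler_pM2l// nvD.
- by move=> k x; rewrite nvZ mulrCA.
- move=> k _ _ /subspace_val_surj[x <-] /subspace_val_surj[y <-].
  by rewrite -subspace_val_linear !hE functionalP.
- by move=> _ /subspace_val_surj[x <-]; rewrite hE -nv_subspace.
have [|f Ef] := @functional_of _ _ S E F (2 * M) FL.
  by move=> x; rewrite -mulrA; exact: Fb.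
exists f => z; rewrite -Ef Ff; first exact: hE.
exact: subspace_valP.
Qed.

(** The weak topology of [Z] is induced from that of [E]: the traces of weak neighbourhoods form a
    filter, and its weak convergence to [z] can be tested on functionals of [Z], all of which extend
    to [E]. *)
Lemma weak_subspace_nbhs (z : subspace_banach Z) (U : set (weak (subspace_banach Z))) :
  nbhs (z : weak (subspace_banach Z)) U ->
  exists2 V, nbhs (val z : weak E) V & [set t | V (val t)] `<=` U.
Proof.
move=> zU.
pose G : set_system (subspace_banach Z) :=
  filter_from (nbhs (val z : weak E)) (fun V => [set t | V (val t)]).
have FG : Filter G.
  apply: filter_from_filter; first by exists setT; exact: filterT.
  by move=> A B zA zB; exists (A `&` B) => //; exact: filterI.
have : G --> (z : weak (subspace_banach Z)).
  apply/(@weak_cvgP _ _ S _ _ G id z FG) => g e e0.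
  have [f fg] := functional_extension g.
  exists [set x | nrm (f (val z) - f x) < e]; first exact: weak_nbhs.
  by move=> t /=; rewrite !fg.
by move=> /(_ _ zU)[V zV VU]; exists V.
Qed.

End Subspaces.

(** * Closed spans, and weakly compact operators *)

Section ClosedSpan.
Context (R : realType) (K : numFieldType) (S : scalars R K).
Local Notation nrm := (nrm S).
Local Notation nv := (nv S).

Section Normed.
Context (E : normedModType K).
Implicit Types (A M : set E).

Lemma nv_closureP A x :
  closure A x <-> forall e : R, 0 < e -> exists2 y, A y & nv (x - y) < e.
Proof.
split=> [Ax e e0|h B /(nv_nbhs S)[e e0 eB]].
  have [|y [Ay xy]] := Ax [set y | nv (x - y) < e].
    by apply/(nv_nbhs S); exists e.
  by exists y.
by have [y Ay xy] := h e e0; exists y; split=> //; exact: eB.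
Qed.

Lemma closure_linear M : linear_set M -> linear_set (closure M).
Proof.
move=> LM; split; first exact/subset_closure/LM.1.
move=> k x y /nv_closureP Mx /nv_closureP My; apply/nv_closureP => e e0.
have d0 : 0 < nrm k + 1 by have := nrm_ge0 S k; lra.
have [x' Mx' xx'] := Mx (e / 2 / (nrm k + 1)) (divr_gt0 (divr_gt0 e0 (ltr0n _ 2)) d0).
have [|y' My' yy'] := My (e / 2); first by lra.
exists (k *: x' + y'); first exact: LM.2.
rewrite opprD addrACA -scalerBr (le_lt_trans (nvD _ _ _))// nvZ.
have : nrm k * nv (x - x') <= (nrm k + 1) * nv (x - x').
  by rewrite ler_wpM2r ?nv_ge0// lerDl.
by rewrite ltr_pdivlMr// mulrC in xx'; lra.
Qed.

Definition closed_linear_subspace M (LM : linear_set M) (cM : closed M) :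
  closedSubspace E.
Proof.
apply: (@ClosedSubspace _ _ M) => //; split; first exact/mem_set/LM.1.
move=> k x y /set_mem Mx /set_mem My; exact/mem_set/LM.2.
Defined.

Definition closed_span A : closedSubspace E :=
  closed_linear_subspace (closure_linear (lin_span_linear A)) (@closed_closure _ _).

Lemma closed_span_sub A : A `<=` closed_span A.
Proof. by move=> x Ax; exact/subset_closure/sub_lin_span. Qed.

Lemma closed_span_min A M : linear_set M -> closed M -> A `<=` M ->
  closed_span A `<=` M.
Proof.
move=> LM cM AM x /=; rewrite [M](closure_id M).1//; apply: closureS.
exact: lin_span_min.
Qed.

Lemma closed_span_min_approx A M : linear_set M -> A `<=` M ->
  (forall x, (forall e : R, 0 < e -> exists2 y, M y & nv (x - y) < e) -> M x) ->
  closed_span A `<=` M.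
Proof.
move=> LM AM cM; apply: closed_span_min => // x Mx.
by apply: cM; exact/nv_closureP.
Qed.

End Normed.

Lemma dense_span (E : completeNormedModType K) (Z : closedSubspace E)
    (A : set (subspace_banach Z)) :
  (forall z, cs_set Z z -> forall e : R, 0 < e ->
     exists2 a, lin_span A a & nv (z - val a) < e) -> dense (lin_span A).
Proof.
move=> h O [z Oz] oO.
have /(nv_nbhs S)[e e0 eO] : nbhs z O by exact: open_nbhs_nbhs.
have [a Aa za] := h _ (subspace_valP z) e e0.
by exists a; split=> //; apply: eO.
Qed.

Lemma weakly_compact_wcg : subclass (weakly_compact_op K) (wcg_op K).
Proof.
move=> E F T; rewrite /weakly_compact_op precompactE => cT.
set C := closure _ in cT.
pose Z := closed_linear_subspace (closure_linear (linear_set_range T)) (@closed_closure _ _).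
have TZ x : cs_set Z (T x) by apply: subset_closure; exists x.
exists Z; split; last by move=> _ [x _ <-].
pose A := [set z : subspace_banach Z | C (val z)].
exists A; split.
  move=> G FG GA.
  have [y [Cy Gy]] : C `&` cluster ((val : subspace_banach Z -> weak F) @ G) !=set0.
    exact: cT.
  (* A norm-closed subspace is weakly closed: a functional vanishing on [Z] also vanishes at any
     weak cluster point of [G]. *)
  have Zy : cs_set Z y.
    apply: contrapT => nZy.
    have [f [fZ /eqP fy]] := closed_separation S (closedSubspace_linear Z) (@cs_closed _ _ Z) nZy.
    apply: fy; apply: (weak_cluster_eq (S := S) _ Gy) => e e0.
    suff : G [set z | nrm (0 - f (val z)) < e] by [].
    by apply: filterS GA => z _ /=; rewrite fZ ?subrr ?nrm0//; exact: subspace_valP.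
  have [z zy] := subspace_val_surj Zy.
  exists z; split; first by rewrite /A /= zy.
  move=> U V GU zV.
  have [V' yV' VV] := weak_subspace_nbhs S zV.
  rewrite zy in yV'.
  have [_ [[t Ut <-] V't]] : val @` U `&` V' !=set0.
    apply: Gy yV'; suff : G [set z | (val @` U) (val z)] by [].
    by apply: filterS GU => t Ut; exists t.
  by exists t; split=> //; exact: VV.
apply: dense_span => z /nv_closureP Zz e e0.
have [_ [x _ <-] zx] := Zz e e0.
have [t tx] := subspace_val_surj (TZ x).
exists t; last by rewrite tx.
(* Adding 1 keeps [k] positive for [x = 0] while [k^-1 *: x] stays in the unit ball. *)
pose k := `|x| + 1 : K.
have k0 : 0 < k by rewrite ltr_wpDl.
have [s sx] := subspace_val_surj (TZ (k^-1 *: x)).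
have As : A s.
  apply: subset_closure; exists (k^-1 *: x) => //=.
  rewrite normrZ normfV (gtr0_norm k0) mulrC ler_pdivrMr// mul1r /k lerDl.
  exact: ler01.
have -> : t = k *: s.
  apply: val_inj; rewrite tx -[k *: s]addr0 subspace_val_linear sx linear0 addr0.
  by rewrite linearZ /= scalerA mulfV ?gt_eqF// scale1r.
by apply: linear_setZ; [exact: lin_span_linear|exact: sub_lin_span].
Qed.

End ClosedSpan.

(** * Spaces of bounded functions *)

Section BoundedFunctions.
Context (R : realType) (K : numFieldType) (S : scalars R K) (I : Type).
Local Notation nrm := (nrm S).
Local Notation nv := (nv S).
Local Notation rl := (rl S).

Definition bounded_fun_pred : {pred (I -> K)} :=
  [pred f | `[< exists M : R, forall i, nrm (f i) <= M >]].

Lemma bounded_fun_submod : submod_closed bounded_fun_pred.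
Proof.
split; first by apply/asboolP; exists 0 => i; rewrite nrm0.
move=> k f g /asboolP[M fM] /asboolP[N gN]; apply/asboolP.
exists (nrm k * M + N) => i; rewrite (le_trans (nrmD _ _ _))// lerD//.
by rewrite nrmM ler_wpM2l ?nrm_ge0.
Qed.

HB.instance Definition _ :=
  GRing.isSubmodClosed.Build K (I -> K) bounded_fun_pred bounded_fun_submod.

Record linf := Linf { linf_fun :> I -> K; _ : linf_fun \in bounded_fun_pred }.

HB.instance Definition _ := [isSub for linf_fun].
HB.instance Definition _ := [Choice of linf by <:].
HB.instance Definition _ := [SubChoice_isSubLmodule of linf by <:].

(** Adjoining 0 keeps the set nonempty when [I] is empty. *)
Definition linf_sup (f : linf) : R := sup ([set 0] `|` range (nrm \o f)).

Let sup_has (f : linf) : has_sup ([set 0] `|` range (nrm \o f)).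
Proof.
split; first by exists 0; left.
have /asboolP[M fM] := valP f; exists (`|M|) => _ [->//|[i _ <-] /=].
exact: le_trans (fM i) (ler_norm M).
Qed.

Let sup_ge (f : linf) i : nrm (f i) <= linf_sup f.
Proof. by apply: sup_upper_bound => //; right; exists i. Qed.

Let sup_ge0 (f : linf) : 0 <= linf_sup f.
Proof. by apply: sup_upper_bound => //; left. Qed.

Let sup_le (f : linf) c : 0 <= c -> (forall i, nrm (f i) <= c) -> linf_sup f <= c.
Proof.
move=> c0 fc; apply: ge_sup; first by exists 0; left.
by move=> _ [->//|[i _ <-]]; exact: fc.
Qed.

Lemma linf_linear k (f g : linf) i : (k *: f + g) i = k * f i + g i.
Proof. by []. Qed.

Let norm (f : linf) : K := rl (linf_sup f).

Let norm_triangle f g : norm (f + g) <= norm f + norm g.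
Proof.
rewrite /norm -rmorphD rl_le; apply: sup_le; first exact: addr_ge0.
move=> i; have -> : (f + g) i = f i + g i by [].
by rewrite (le_trans (nrmD _ _ _))// lerD.
Qed.

Let norm_scale (l : K) f : norm (l *: f) = `|l| * norm f.
Proof.
have le k g : linf_sup (k *: g) <= nrm k * linf_sup g.
  apply: sup_le; first by rewrite mulr_ge0// nrm_ge0.
  by move=> i; rewrite (_ : (k *: g) i = k * g i)// nrmM ler_wpM2l// nrm_ge0.
rewrite /norm (nrmE S) -rmorphM; congr (rl _); apply/eqP; rewrite eq_le le /=.
have [->|l0] := eqVneq l 0; first by rewrite nrm0 mul0r.
have ln : 0 < nrm l by apply: nrm_gt0; exact/eqP.
have := le l^-1 (l *: f); rewrite scalerA mulVf// scale1r nrmV.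
by rewrite mulrC ler_pdivlMr// mulrC.
Qed.

Let norm_eq0 f : norm f = 0 -> f = 0.
Proof.
move=> /eqP; rewrite /norm -(rmorph0 rl) (inj_eq (@rl_inj _ _ S)) => /eqP f0.
apply/val_inj/funext => i; apply: (@nrm_eq0 _ _ S).
by apply/eqP; rewrite eq_le nrm_ge0 andbT -f0 sup_ge.
Qed.

HB.instance Definition _ :=
  Lmodule_isNormed.Build K linf norm_triangle norm_scale norm_eq0.

Lemma nv_linfE (f : linf) : nv f = linf_sup f.
Proof. by apply: (@rl_inj _ _ S); rewrite -nvE. Qed.

Lemma nrm_le_linf (f : linf) i : nrm (f i) <= nv f.
Proof. by rewrite nv_linfE. Qed.

Lemma linf_norm_le (f : linf) c :
  0 <= c -> (forall i, nrm (f i) <= c) -> nv f <= c.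
Proof. by rewrite nv_linfE; exact: sup_le. Qed.

Lemma linf_norming (f : linf) : f <> 0 -> exists i, nv f <= 2 * nrm (f i).
Proof.
move=> /(nv_gt0 S) f0; apply: contrapT => h.
have : nv f <= nv f / 2.
  apply: linf_norm_le => [|i]; first by lra.
  by rewrite leNgt; apply/negP => fi; apply: h; exists i; lra.
lra.
Qed.

(* The zero function if [h] is unbounded. *)
Definition linf_mk (h : I -> K) : linf := insubd 0 h.

Lemma linf_mkE (h : I -> K) (M : R) : (forall i, nrm (h i) <= M) ->
  linf_mk h = h :> (I -> K).
Proof.
by move=> hM; rewrite /linf_mk insubdK//; apply/asboolP; exists M.
Qed.

Let linf_complete (F : set_system linf) : ProperFilter F -> cauchy F -> cvg F.
Proof.
move=> FF /cauchyP Fc.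
have {}Fc (e : R) : 0 < e -> exists f : linf, F [set g | nv (f - g) < e].
  move=> e0; have [|f Ff] := Fc (rl e); first by rewrite rl_gt0.
  exists f; suff <- : ball f (rl e) = [set g | nv (f - g) < e] by [].
  by apply/seteqP; split=> g; rewrite -ball_normE /= (nvE S) rl_lt.
have pt i : exists l, forall e : R, 0 < e -> F [set g | nrm (l - g i) < e].
  pose G : set_system K := (fun f : linf => f i) @ F.
  have [e e0|l Gl] := @scalar_complete _ _ S G _.
    have [f Ff] := Fc e e0; exists (f i).
    suff : F [set g | nrm (g i - f i) < e] by [].
    apply: filterS Ff => g /=; apply: le_lt_trans.
    by rewrite (nrmB S); exact: (nrm_le_linf (f - g) i).
  by exists l => e /Gl.
have [l Fl] := choice pt.
have close (f : linf) (e : R) : F [set g | nv (f - g) < e] ->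
    forall i, nrm (l i - f i) <= e.
  move=> Ff i; apply/ler_addgt0Pr => e' e'0.
  have [g [/= lg fg]] := filter_ex (filterI (Fl i e' e'0) Ff).
  have := nrmD S (l i - g i) (g i - f i); rewrite subrKA => /le_trans; apply.
  rewrite addrC lerD//; last exact: ltW.
  by rewrite (nrmB S); apply: le_trans (ltW fg); exact: (nrm_le_linf (f - g) i).
have [f1 Ff1] := Fc 1 ltr01.
pose h := linf_mk l.
have hl : h = l :> (I -> K).
  apply: (@linf_mkE l (1 + nv f1)) => i.
  rewrite -[l i](subrK (f1 i)) (le_trans (nrmD _ _ _))// lerD//.
    exact: close.
  exact: nrm_le_linf.
apply/cvg_ex; exists h; apply/(nv_cvg S) => e e0.
have e2 : 0 < e / 2 by lra.
have [f Ff] := Fc _ e2.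
apply: filterS (Ff) => g /= fg.
have : nv (h - f) <= e / 2.
  apply: linf_norm_le => [|i]; first exact: ltW.
  by rewrite (_ : (h - f) i = l i - f i) ?close// -hl.
have := nv_trans S f h g; lra.
Qed.

HB.instance Definition _ := Uniform_isComplete.Build linf linf_complete.

End BoundedFunctions.

(** * The space of null sequences *)

Section SequenceSpace.
Context (R : realType) (K : numFieldType) (S : scalars R K).
Local Notation nrm := (nrm S).
Local Notation nv := (nv S).
Local Notation rl := (rl S).

Lemma norm_le1 (E : normedModType K) (x : E) : (`|x| <= 1) = (nv x <= 1).
Proof. by rewrite (nvE S) -(rmorph1 rl) rl_le. Qed.

Definition phase (k : K) : K := rl (nrm k) / k.

Lemma phaseM k : phase k * k = rl (nrm k).
Proof.
have [->|k0] := eqVneq k 0; first by rewrite mulr0 nrm0 rmorph0.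
by rewrite /phase divfK.
Qed.

Lemma nrm_phase k : nrm (phase k) <= 1.
Proof.
rewrite /phase nrmM nrmV nrm_rl ger0_norm ?nrm_ge0//.
have [->|/eqP k0] := eqVneq k 0; first by rewrite nrm0 mul0r.
by rewrite divff// gt_eqF// nrm_gt0.
Qed.

(* Unconditional boundedness of the partial sums gives
   [\sum_i |f (u i)| <= ||f||] for every functional [f]. *)
Lemma weakly_null_of_unconditional (E : normedModType K) (u : nat -> E) :
  (forall n (c : nat -> K), (forall i, nrm (c i) <= 1) ->
     nv (\sum_(i < n) c i *: u i) <= 1) ->
  (u : nat -> weak E) @ \oo --> (0 : weak E).
Proof.
move=> uu; apply/(weak_cvgP S) => f e e0.
have [M M0 fM] := functional_bound S f.
pose a n := nrm (f (u n)).
have a0 n : 0 <= a n by exact: nrm_ge0.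
have sM n : series a n <= M.
  pose c n := phase (f (u n)).
  have := fM (\sum_(i < n) c i *: u i).
  rewrite linear_sum.
  have -> : \sum_(i < n) f (c i *: u i) = rl (series a n) :> K.
    rewrite /series /= big_mkord rmorph_sum; apply: eq_bigr => i _.
    by rewrite linearZ; exact: phaseM.
  rewrite nrm_rl => /(le_trans (ler_norm _)) /le_trans; apply.
  by rewrite ler_piMr ?uu// => [|i]; [exact: ltW|exact: nrm_phase].
have : cvgn (series a).
  apply: nondecreasing_is_cvgn; last by exists M => _ [n _ <-].
  by apply/nondecreasing_seqP => n; rewrite /series /= big_nat_recr //= lerDl.
move=> /cvg_series_cvg_0/cvgrPdist_lt/(_ e e0).
apply: filterS => n /=.
by rewrite linear0 !sub0r normrN nrmN ger0_norm.
Qed.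

Lemma weakly_null_compact (E : normedModType K) (u : nat -> E) :
  (u : nat -> weak E) @ \oo --> (0 : weak E) ->
  compact (0 |` range u : set (weak E)).
Proof.
move=> u0 G FG GA; apply: contrapT => nc.
have far (x : E) : (0 |` range u) x ->
    exists U V, [/\ G U, nbhs (x : weak E) V & U `&` V = set0].
  move=> Ax; apply: contrapT => nUV; apply: nc; exists x; split=> // U V GU xV.
  by apply/set0P/eqP => UV; apply: nUV; exists U, V.
have [U [V [GU V0 UV]]] := far 0 (or_introl erefl).
have /= [N _ uN] := u0 V V0.
have [W GW Wu] : exists2 W, G W & forall n, (n < N)%N -> ~ W (u n).
  elim: N {uN} => [|N [W GW Wu]]; first by exists setT => //; exact: filterT.
  have [|U' [V' [GU' uV' UV']]] := far (u N); first by right; exists N.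
  exists (W `&` U'); first exact: filterI.
  move=> n; rewrite ltnS leq_eqVlt => /orP[/eqP -> [_ U'N]|/Wu WN [/WN//]].
  suff : set0 (u N) by [].
  by rewrite -UV'; split=> //; exact: nbhs_singleton uV'.
have [x [[x0|[n _ xn]] [Ux Wx]]] := filter_ex (filterI GA (filterI GU GW)).
  suff : set0 x by [].
  by rewrite -UV x0; split; [rewrite -x0|exact: nbhs_singleton V0].
have [nN|Nn] := ltnP n N; first by apply: (Wu n nN); rewrite xn.
suff : set0 x by [].
by rewrite -UV; split=> //; rewrite -xn; exact: uN.
Qed.

Definition unit_vector n : linf S nat := linf_mk S (fun k => (k == n)%:R).

Lemma unit_vectorE n k : unit_vector n k = (k == n)%:R.
Proof.
rewrite /unit_vector (@linf_mkE _ _ S nat _ 1)// => i.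
by case: (i == n); rewrite ?nrm0 ?nrm1.
Qed.

Definition c0 : closedSubspace (linf S nat) := closed_span S (range unit_vector).

Local Notation X := (subspace_banach c0).

Definition c0_unit n : X :=
  SubspaceBanach (mem_set (closed_span_sub S (imageT unit_vector n)) :
    unit_vector n \in subspace_pred c0).

Lemma c0_vanish (x : X) (e : R) : 0 < e ->
  exists N, forall k, (N <= k)%N -> nrm (val x k) < e.
Proof.
move: e; have := subspace_valP x; move: (val x) => {x}.
apply: (@closed_span_min_approx _ _ S _ _
  [set x : linf S nat | forall e, 0 < e -> exists N, forall k, (N <= k)%N -> nrm (x k) < e]).
- split=> [e e0|k x y hx hy e e0]; first by exists 0%N => k _; rewrite nrm0.
  have d0 : 0 < nrm k + 1 by have := nrm_ge0 S k; lra.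
  have e2 : 0 < e / 2 by lra.
  have [N xN] := hx _ (divr_gt0 e2 d0); have [N' yN] := hy _ e2.
  exists (maxn N N') => i; rewrite geq_max => /andP[/xN xi /yN yi].
  rewrite linf_linear (le_lt_trans (nrmD _ _ _))// nrmM.
  rewrite ltr_pdivlMr// mulrC in xi.
  have : nrm k * nrm (x i) <= (nrm k + 1) * nrm (x i).
    by rewrite ler_wpM2r ?nrm_ge0// lerDl.
  lra.
- move=> _ [n _ <-] e e0; exists n.+1 => k nk.
  by rewrite unit_vectorE gtn_eqF// nrm0.
- move=> x h e e0; have e2 : 0 < e / 2 by lra.
  have [y hy xy] := h _ e2; have [N yN] := hy _ e2.
  exists N => k /yN; have := nrm_le_linf (x - y) k.
  rewrite (_ : (x - y) k = x k - y k)// => h1 h2.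
  have := nrmD S (x k - y k) (y k); rewrite subrK; lra.
Qed.

Lemma c0_coord k : exists f : dual_space X, forall x, f x = val x k.
Proof.
have [||f Ef] := @functional_of _ _ S X (fun x => val x k) 1.
- by move=> c x y; rewrite subspace_val_linear.
- by move=> x; rewrite mul1r nv_subspace; exact: nrm_le_linf.
by exists f => x; rewrite -Ef.
Qed.

Lemma unit_vector_sum n (c : nat -> K) k :
  (\sum_(i < n) c i *: unit_vector i) k = if (k < n)%N then c k else 0.
Proof.
elim: n => [|n IH]; first by rewrite big_ord0.
rewrite big_ord_recr /= (_ : (_ + _) k =
  (\sum_(i < n) c i *: unit_vector i) k + c n * unit_vector n k)//.
rewrite IH unit_vectorE ltnS; have [kn|nk|->] := ltngtP k n.
- by rewrite mulr0 addr0.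
- by rewrite mulr0 addr0.
- by rewrite mulr1 add0r.
Qed.

Lemma unit_vector_sum_le n (c : nat -> K) : (forall i, nrm (c i) <= 1) ->
  nv (\sum_(i < n) c i *: unit_vector i) <= 1.
Proof.
move=> c1; apply: linf_norm_le => // k; rewrite unit_vector_sum.
by case: ifP; rewrite ?nrm0.
Qed.

Lemma c0_unit_sum n (c : nat -> K) :
  val (\sum_(i < n) c i *: c0_unit i) = \sum_(i < n) c i *: unit_vector i.
Proof. by rewrite linear_sum; apply: eq_bigr => i _; rewrite linearZ. Qed.

Lemma c0_unit_weakly_null : (c0_unit : nat -> weak X) @ \oo --> (0 : weak X).
Proof.
apply: weakly_null_of_unconditional => n c c1.
by rewrite nv_subspace c0_unit_sum unit_vector_sum_le.
Qed.

Lemma identity_operator (E : normedModType K) :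
  exists T : operator E E, forall x, T x = x.
Proof.
have [|x|T ET] := @operator_of _ _ S E E id 1; first by [].
  by rewrite mul1r.
by exists T => x; rewrite -ET.
Qed.

Lemma c0_not_finite_span (A : set X) : finite_set A -> lin_span A <> setT.
Proof.
move=> fA AT; have [f fE] := choice c0_coord.
have [|s sf] := @functionals_of_finite_span K X nat (fun k x => val x k) A _ fA.
  by move=> k c x y; rewrite subspace_val_linear.
have [N sN] : exists N, forall t, List.In t s -> (t < N)%N.
  elim: {sf} s => [|t s [N sN]]; first by exists 0%N.
  exists (maxn t.+1 N) => t' [<-|/sN h]; first by rewrite leq_max ltnSn.
  by rewrite leq_max h orbT.
have := sf (c0_unit N); rewrite AT => /(_ Logic.I).
have h t : List.In t s -> val (c0_unit N) t = 0.
  by move=> /sN tN; rewrite /= unit_vectorE ltn_eqF.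
by move=> /(_ h N) /=; rewrite unit_vectorE eqxx => /eqP; rewrite oner_eq0.
Qed.

(** The weakly null unit vectors together with 0 form a generating weakly compact set. The partial
    sums of the unit vectors lie in the unit ball, but a weak cluster point would be the constant
    sequence 1. The unit vectors are weakly null with mutual distance 1. The whole space and the
    zero subspace refute strict singularity and strict cosingularity. *)
Lemma c0_identity : exists T : operator X X,
  [/\ wcg_op K _ _ T, ~ weakly_compact_op K _ _ T,
    ~ completely_continuous K _ _ T, ~ strictly_singular K _ _ T &
    ~ strictly_cosingular K _ _ T].
Proof.
have [T TE] := identity_operator X; exists T; split.
- have ZT : linear_set [set: X] by [].
  pose Z := closed_linear_subspace ZT closedT.
  have /choice[w wE] : forall n, exists z : subspace_banach Z, val z = c0_unit n.
    by move=> n; exact: subspace_val_surj.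
  exists Z; split => //; exists (0 |` range w); split.
    apply: weakly_null_compact; apply: weakly_null_of_unconditional => n c c1.
    rewrite nv_subspace linear_sum.
    rewrite (eq_bigr (fun i : 'I_n => c i *: c0_unit i)); last first.
      by move=> i _; rewrite -wE; exact: linearZ.
    by rewrite nv_subspace c0_unit_sum unit_vector_sum_le.
  apply: (@dense_span _ _ S _ Z) => z _ e e0.
  have /(nv_closureP S)/(_ e e0)[y hy zy] := subspace_valP z.
  suff [a ha ay] : exists2 a, lin_span (0 |` range w) a & val (val a) = y.
    by exists a => //; rewrite nv_subspace; move: zy; rewrite -ay.
  move: y hy {zy}; apply: lin_span_min.
    split; first by exists 0 => //; exact: (lin_span_linear _).1.
    move=> k _ _ [a ha <-] [b hb <-]; exists (k *: a + b).
      exact: (lin_span_linear _).2.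
    by rewrite !subspace_val_linear.
  move=> _ [n _ <-]; exists (w n); last by rewrite wE.
  by apply: sub_lin_span; right; exists n.
- rewrite /weakly_compact_op precompactE; set C := closure _ => cC.
  pose s n : X := \sum_(i < n) 1 *: c0_unit i.
  have sC n : C (s n : weak X).
    apply: subset_closure; exists (s n); last exact: TE.
    rewrite /= norm_le1 nv_subspace /s (c0_unit_sum n (fun=> 1)).
    by rewrite (@unit_vector_sum_le n (fun=> 1))// => i; rewrite nrm1.
  have [|y [_ Gy]] := cC ((s : nat -> weak X) @ \oo) _; first by exists 0%N => // n _; exact: sC.
  have [N /(_ N (leqnn N))] := c0_vanish (y : X) (ltr01 : 0 < 1 :> R).
  have [f fE] := c0_coord N.
  rewrite -fE (weak_cluster_eq (S := S) _ Gy (c := 1)) ?nrm1 ?ltxx// => e e0.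
  exists N.+1 => // n /= Nn.
  by rewrite fE /s (c0_unit_sum n (fun=> 1)) (unit_vector_sum n (fun=> 1)) Nn subrr nrm0.
- move=> /(_ _ _ c0_unit_weakly_null) /cvg_ex[l].
  have d : 0 < 2^-1 :> R by rewrite invr_gt0.
  move=> /(nv_cvg S)/(_ _ d)[N _ hN].
  have := hN N (leqnn N); have := hN N.+1 (leqnSn N); rewrite /= !TE => h1 h2.
  have h12 := ltrD h2 h1; rewrite (_ : 2^-1 + 2^-1 = 1) in h12; last by lra.
  have h3 := nv_trans S l (c0_unit N) (c0_unit N.+1).
  rewrite (nvB S (c0_unit N) l) in h3.
  suff h4 : 1 <= nv (c0_unit N - c0_unit N.+1).
    by have := le_lt_trans (le_trans h4 h3) h12; rewrite ltxx.
  rewrite nv_subspace; apply: le_trans (nrm_le_linf _ N).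
  have -> : val (c0_unit N - c0_unit N.+1) N = unit_vector N N - unit_vector N.+1 N by [].
  by rewrite !unit_vectorE eqxx ltn_eqF// subr0 nrm1.
- have ZT : linear_set [set: X] by [].
  move=> /(_ (closed_linear_subspace ZT closedT)); apply.
    by move=> [A fA /esym AT]; exact: c0_not_finite_span AT.
  by exists 1 => // x _; rewrite mul1r TE.
- have Z0 : linear_set [set 0 : X].
    by split=> // k _ _ -> ->; rewrite /= scaler0 addr0.
  have cl0 : closed [set 0 : X].
    move=> x /(nv_closureP S) x0; apply: contrapT => /(nv_gt0 S)/x0[_ ->].
    by rewrite subr0 ltxx.
  move=> /(_ (closed_linear_subspace Z0 cl0)); apply; last first.
    by move=> _ [x _ <-]; exists x => //=; rewrite TE.
  move=> [A fA hA]; apply: (@c0_not_finite_span A fA).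
  apply/seteqP; split=> // x _.
  have [a Aa ax] := hA _ (imageT _ x).
  have : quotient_map (closed_linear_subspace Z0 cl0) x a.
    by rewrite -ax /quotient_map /= subrr.
  by move=> /eqP; rewrite subr_eq0 => /eqP <-.
Qed.

End SequenceSpace.

(** * The space of summable functions *)

Section ClosedSpanInduction.
Context (R : realType) (K : numFieldType) (S : scalars R K).
Context (E : completeNormedModType K) (A : set E).
Local Notation X := (subspace_banach (closed_span S A)).
Local Notation nrm := (nrm S).
Local Notation nv := (nv S).

Lemma closed_span_ind (P : set X) : linear_set P ->
  (forall x, (forall e : R, 0 < e -> exists2 y, P y & nv (x - y) < e) -> P x) ->
  (forall x : X, A (val x) -> P x) -> forall x, P x.
Proof.
move=> LP cP AP x.
suff : [set y | exists2 z, P z & val z = y] (val x) by move=> [z Pz /val_inj <-].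
apply: (closed_span_min_approx (S := S) (A := A)); last exact: subspace_valP.
- split; first by exists 0 => //; exact: LP.1.
  move=> k _ _ [a Pa <-] [b Pb <-]; exists (k *: a + b); first exact: LP.2.
  exact: subspace_val_linear.
- move=> a Aa; have [z za] := subspace_val_surj (closed_span_sub S Aa).
  by exists z => //; apply: AP; rewrite za.
move=> y hy; have [z zy] : exists z : X, val z = y.
  apply: subspace_val_surj; apply: (@cs_closed _ _ (closed_span S A)).
  apply/(nv_closureP S) => e /hy[_ [z _ <-] yz]; exists (val z) => //.
  exact: subspace_valP.
exists z => //; apply: cP => e /hy[_ [w Pw <-] yw]; exists w => //.
by rewrite nv_subspace; move: yw; rewrite -zy.
Qed.

Lemma closed_span_functional_eq0 (D : X -> K) (C : R) :
  (forall k x y, D (k *: x + y) = k * D x + D y) ->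
  (forall x, nrm (D x) <= C * nv x) ->
  (forall x : X, A (val x) -> D x = 0) -> forall x, D x = 0.
Proof.
move=> DL DC D0.
have D00 : D 0 = 0.
  by have := DL (-1) 0 0; rewrite scaleN1r oppr0 addr0 mulN1r addNr.
apply: (closed_span_ind (P := [set x | D x = 0])) => //.
  by split=> // k x y /= Dx Dy; rewrite DL Dx Dy mulr0 addr0.
move=> x h; apply: contrapT => /(nrm_gt0 S) Dx.
have C0 : 0 < `|C| + 1 by have := normr_ge0 C; lra.
have [y /= Dy xy] := h _ (divr_gt0 Dx C0).
have Dxy : D x = D (x - y).
  by have := DL 1 (x - y) y; rewrite scale1r subrK Dy mul1r addr0.
move: xy; rewrite ltr_pdivlMr// mulrC ltNge => /negP; apply.
rewrite {1}Dxy (le_trans (DC _))// ler_wpM2r ?nv_ge0//.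
by have := ler_norm C; lra.
Qed.

End ClosedSpanInduction.

Section SummableFunctions.
Context (R : realType) (K : numFieldType) (S : scalars R K) (T : eqType).
Local Notation nrm := (nrm S).
Local Notation nv := (nv S).
Local Notation rl := (rl S).
Local Notation B := (linf S T).
Implicit Types (t : T) (phi psi : B).

Definition weight phi : R := 1 + nv phi.

Lemma weight_gt0 phi : 0 < weight phi.
Proof. by rewrite ltr_wpDr ?nv_ge0. Qed.

(* Elements of l^1(T) are encoded as functionals on the bounded functions on
   [T]. The weight makes a functional a bounded function on the whole of [B]. *)
Definition delta t : linf S B :=
  linf_mk S (fun phi => rl (weight phi)^-1 * phi t).

Lemma deltaE t phi : delta t phi = rl (weight phi)^-1 * phi t.
Proof.
rewrite /delta (@linf_mkE _ _ S B _ 1)// => psi.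
rewrite nrmM nrm_rl gtr0_norm ?invr_gt0 ?weight_gt0// mulrC.
rewrite ler_pdivrMr ?weight_gt0// mul1r (le_trans (nrm_le_linf _ _))//.
by rewrite /weight lerDr.
Qed.

(** The induced norm is the l^1 norm: an element of l^1 norm [a] reaches weighted values up to
    [a * r / (1 + r)] on the [phi] of norm [r], and the supremum over [r] is [a]. *)
Definition l1 : closedSubspace (linf S B) := closed_span S (range delta).

Local Notation X := (subspace_banach l1).

Definition l1_delta t : X :=
  SubspaceBanach (mem_set (closed_span_sub S (imageT delta t)) :
    delta t \in subspace_pred l1).

Definition pairing (x : X) phi : K := rl (weight phi) * val x phi.

Lemma pairingDl k x y phi :
  pairing (k *: x + y) phi = k * pairing x phi + pairing y phi.
Proof. by rewrite /pairing subspace_val_linear linf_linear; ring. Qed.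

Lemma pairing_le x phi : nrm (pairing x phi) <= weight phi * nv x.
Proof.
rewrite /pairing nrmM nrm_rl gtr0_norm ?weight_gt0// ler_pM2l ?weight_gt0//.
exact: nrm_le_linf.
Qed.

Lemma pairing_delta t phi : pairing (l1_delta t) phi = phi t.
Proof.
rewrite /pairing /= deltaE mulrA -rmorphM mulfV ?rmorph1 ?mul1r// gt_eqF//.
exact: weight_gt0.
Qed.

Lemma nv_l1_delta t : nv (l1_delta t) <= 1.
Proof.
rewrite nv_subspace; apply: linf_norm_le => // phi.
rewrite /= deltaE nrmM nrm_rl gtr0_norm ?invr_gt0 ?weight_gt0// mulrC.
rewrite ler_pdivrMr ?weight_gt0// mul1r (le_trans (nrm_le_linf _ _))//.
by rewrite /weight lerDr.
Qed.

Lemma range_delta (x : X) : range delta (val x) -> exists t, x = l1_delta t.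
Proof. by move=> [t _ tx]; exists t; apply: val_inj; rewrite -tx. Qed.

(** An element of [linf S B] need not be linear in [phi]; linearity holds at the unit vectors and
    passes to their closed span. *)
Lemma pairingDr x k phi psi :
  pairing x (k *: phi + psi) = k * pairing x phi + pairing x psi.
Proof.
apply/eqP; rewrite -subr_eq0; apply/eqP; move: x.
apply: (closed_span_functional_eq0 (S := S)
  (C := weight (k *: phi + psi) + nrm k * weight phi + weight psi)).
- by move=> c x y; rewrite !pairingDl; ring.
- move=> x; apply: le_trans (nrmD _ _ _) _; rewrite nrmN.
  have h1 := pairing_le x (k *: phi + psi); have h3 := pairing_le x psi.
  have h2 := ler_wpM2l (nrm_ge0 S k) (pairing_le x phi).
  have h4 := nrmD S (k * pairing x phi) (pairing x psi); rewrite nrmM in h4.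
  rewrite [leRHS]mulrDl [X in _ <= X + _]mulrDl -addrA lerD//.
  by rewrite (le_trans h4)// lerD// -mulrA.
- by move=> _ /range_delta[t ->]; rewrite !pairing_delta linf_linear subrr.
Qed.

Lemma pairing0r x : pairing x 0 = 0.
Proof.
by have := pairingDr x (-1) 0 0; rewrite scaleN1r oppr0 addr0 mulN1r addNr.
Qed.

Lemma pairingD x phi psi : pairing x (phi + psi) = pairing x phi + pairing x psi.
Proof. by have := pairingDr x 1 phi psi; rewrite scale1r mul1r. Qed.

Lemma pairingZ x k phi : pairing x (k *: phi) = k * pairing x phi.
Proof. by have := pairingDr x k phi 0; rewrite addr0 pairing0r addr0. Qed.

Lemma pairing_functional phi : exists f : dual_space X, forall x, f x = pairing x phi.
Proof.
have [|x|f Ef] := @functional_of _ _ S X (pairing^~ phi) (weight phi).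
- by move=> k x y; exact: pairingDl.
- exact: pairing_le.
by exists f => x; rewrite -Ef.
Qed.

Lemma pairing_norming x : x <> 0 ->
  exists2 psi : B, nv psi <= 1 & nv x <= 2 * nrm (pairing x psi).
Proof.
move=> x0; have [|phi xphi] := @linf_norming _ _ S B (val x).
  by move=> vx; apply: x0; exact: val_inj.
exists (rl (weight phi)^-1 *: phi).
  rewrite nvZ nrm_rl gtr0_norm ?invr_gt0 ?weight_gt0// mulrC.
  by rewrite ler_pdivrMr ?weight_gt0// mul1r /weight lerDr.
rewrite pairingZ /pairing mulrA -rmorphM mulVf ?rmorph1 ?mul1r//.
by rewrite gt_eqF// weight_gt0.
Qed.

Lemma pairing_represents (f : dual_space X) :
  exists2 phi : B, (forall t, phi t = f (l1_delta t)) & forall x, f x = pairing x phi.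
Proof.
have [M M0 fM] := functional_bound S f.
pose phi : B := linf_mk S (fun t => f (l1_delta t) : K).
have phiE t : phi t = f (l1_delta t).
  rewrite /phi (@linf_mkE _ _ S T _ M)// => t'.
  by rewrite (le_trans (fM _))// ler_piMr ?nv_l1_delta// ltW.
exists phi => // x; apply/eqP; rewrite -subr_eq0; apply/eqP; move: x.
apply: (closed_span_functional_eq0 (S := S) (C := M + weight phi)).
- by move=> c x y; rewrite functionalP pairingDl; ring.
- move=> x; rewrite (le_trans (nrmD _ _ _))// nrmN mulrDl lerD//.
  exact: pairing_le.
- by move=> _ /range_delta[t ->]; rewrite pairing_delta phiE subrr.
Qed.

(** Summability in dual form. The bound 2 accommodates the difference of two functions of norm at
    most 1, as needed in [schur]. *)
Lemma pairing_tail x (e : R) : 0 < e -> exists s : seq T,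
  forall phi, nv phi <= 2 -> (forall t, t \in s -> phi t = 0) ->
  nrm (pairing x phi) <= e.
Proof.
move: x e; apply: (closed_span_ind (S := S) (P := [set x : X | forall e : R, 0 < e ->
  exists s : seq T, forall phi, nv phi <= 2 -> (forall t, t \in s -> phi t = 0) ->
  nrm (pairing x phi) <= e])).
- split.
    move=> e e0; exists [::] => phi _ _; rewrite /pairing /=.
    by rewrite mulr0 nrm0 ltW.
  move=> k x y hx hy e e0.
  have k0 : 0 < nrm k + 1 by have := nrm_ge0 S k; lra.
  have e2 : 0 < e / 2 by lra.
  have [s sx] := hx _ (divr_gt0 e2 k0); have [s' sy] := hy _ e2.
  exists (s ++ s') => phi p2 ps.
  have hx' : nrm (pairing x phi) * (nrm k + 1) <= e / 2.
    rewrite -ler_pdivlMr//; apply: sx => // t ts.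
    by apply: ps; rewrite mem_cat ts.
  have hy' : nrm (pairing y phi) <= e / 2.
    by apply: sy => // t ts; apply: ps; rewrite mem_cat ts orbT.
  rewrite pairingDl (le_trans (nrmD _ _ _))// nrmM.
  have := nrm_ge0 S (pairing x phi); lra.
- move=> x h e e0; have e6 : 0 < e / 6 by lra.
  have [y hy xy] := h _ e6; have e2 : 0 < e / 2 by lra.
  have [s sy] := hy _ e2; exists s => phi p2 ps.
  have -> : pairing x phi = pairing (1 *: (x - y) + y) phi by rewrite scale1r subrK.
  rewrite pairingDl mul1r (le_trans (nrmD _ _ _))//.
  have h1 := sy phi p2 ps; have h2 := pairing_le (x - y) phi.
  have h3 : weight phi * nv (x - y) <= 3 * (e / 6).
    rewrite ler_pM ?nv_ge0 ?(ltW (weight_gt0 _)) ?(ltW xy)// /weight.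
    by move: p2; lra.
  lra.
- move=> _ /range_delta[t ->] e e0; exists [:: t] => phi _ pt.
  by rewrite pairing_delta pt ?inE// nrm0 ltW.
Qed.

Definition restrict (P : pred T) phi : B :=
  linf_mk S (fun t => if P t then phi t else 0).

Lemma restrictE P phi t : restrict P phi t = if P t then phi t else 0.
Proof.
rewrite /restrict (@linf_mkE _ _ S T _ (nv phi))// => t'.
by case: ifP => _; [exact: nrm_le_linf|rewrite nrm0 nv_ge0].
Qed.

Lemma nv_restrict P phi : nv (restrict P phi) <= nv phi.
Proof.
apply: linf_norm_le => [|t]; first exact: nv_ge0.
by rewrite restrictE; case: ifP => _; [exact: nrm_le_linf|rewrite nrm0 nv_ge0].
Qed.

(** * The Schur property of l^1 *)

Section Schur.
Variable u : nat -> X.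
Hypothesis u0 : (u : nat -> weak X) @ \oo --> (0 : weak X).

Lemma pairing_cvg0 phi (e : R) : 0 < e ->
  exists N, forall n, (N <= n)%N -> nrm (pairing (u n) phi) < e.
Proof.
move=> e0; have [f fE] := pairing_functional phi.
have /(weak_cvgP S)/(_ f e e0)[N _ hN] := u0.
by exists N => n /hN /=; rewrite linear0 sub0r nrmN fE.
Qed.

Lemma pairing_finite_cvg0 (s : seq T) (e : R) : 0 < e ->
  exists N, forall n, (N <= n)%N -> forall phi, nv phi <= 2 ->
    (forall t, t \notin s -> phi t = 0) -> nrm (pairing (u n) phi) <= e.
Proof.
elim: s e => [|t s IH] e e0.
  exists 0%N => n _ phi _ p0; have -> : phi = 0.
    by apply/val_inj/funext => t; exact: p0.
  by rewrite pairing0r nrm0 ltW.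
have e2 : 0 < e / 2 by lra.
have e4 : 0 < e / 4 by lra.
pose one : B := linf_mk S (fun t' => (t' == t)%:R).
have oneE t' : one t' = (t' == t)%:R.
  rewrite /one (@linf_mkE _ _ S T _ 1)// => x.
  by case: (x == t); rewrite ?nrm0 ?nrm1.
have [N hN] := IH _ e2; have [N' hN'] := pairing_cvg0 one e4.
exists (maxn N N') => n; rewrite geq_max => /andP[/hN{}hN /hN'{}hN'] phi p2 ps.
have -> : phi = phi t *: one + restrict (predC1 t) phi.
  apply/val_inj/funext => t'; apply/esym.
  rewrite [LHS](_ : _ = phi t * one t' + restrict (predC1 t) phi t')//.
  rewrite oneE restrictE /=; have [->|_] := eqVneq t' t.
    by rewrite mulr1 addr0.
  by rewrite mulr0 add0r.
rewrite pairingDr (le_trans (nrmD _ _ _))// nrmM.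
have h1 : nrm (pairing (u n) (restrict (predC1 t) phi)) <= e / 2.
  apply: hN; first exact: le_trans (nv_restrict _ _) p2.
  move=> t' t's; rewrite restrictE /=; case: eqP => //= /eqP tt'.
  by apply: ps; rewrite inE negb_or tt'.
have h2 : nrm (phi t) * nrm (pairing (u n) one) <= 2 * (e / 4).
  apply: ler_pM; rewrite ?nrm_ge0 ?(ltW hN')//.
  exact: le_trans (nrm_le_linf _ _) p2.
lra.
Qed.

(** Selection of one hump. The state [p] holds the coordinates already used and a lower bound for
    the index. Far out, [u n] is small on the old coordinates, and it is small off a larger finite
    set, so it lives essentially on the newly added ones. *)
Lemma schur_step (e : R) : 0 < e ->
  (forall N, exists2 n, (N <= n)%N & e <= nv (u n)) ->
  forall p : seq T * nat, exists q : (seq T * nat) * B,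
   [/\ (p.2 <= q.1.2)%N, {subset p.1 <= q.1.1}, nv q.2 <= 1,
     e / 2 <= nrm (pairing (u q.1.2) q.2) &
     forall phi, nv phi <= 2 -> (forall t, t \in q.1.1 -> t \notin p.1 -> phi t = 0) ->
       nrm (pairing (u q.1.2) phi) <= e / 4].
Proof.
move=> e0 hu [s N] /=; have e8 : 0 < e / 8 by lra.
have [N1 hN1] := pairing_finite_cvg0 s e8.
have [n] := hu (maxn N N1); rewrite geq_max => /andP[Nn /hN1{}hN1] un.
have [|psi p1 unpsi] := @pairing_norming (u n).
  by move=> un0; move: un; rewrite un0 nv0; lra.
have [s' hs'] := pairing_tail (u n) e8.
exists ((s ++ s', n), psi); split => //=.
- by move=> t ts; rewrite mem_cat ts.
- lra.
move=> phi p2 ps.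
have -> : phi = restrict (mem s) phi + restrict (predC (mem s)) phi.
  apply/val_inj/funext => t; apply/esym.
  rewrite [LHS](_ : _ = restrict (mem s) phi t + restrict (predC (mem s)) phi t)//.
  by rewrite !restrictE /=; case: (t \in s); rewrite ?addr0 ?add0r.
rewrite pairingD (le_trans (nrmD _ _ _))//.
have h1 : nrm (pairing (u n) (restrict (mem s) phi)) <= e / 8.
  apply: hN1; first exact: le_trans (nv_restrict _ _) p2.
  by move=> t; rewrite restrictE /= => /negPf ->.
have h2 : nrm (pairing (u n) (restrict (predC (mem s)) phi)) <= e / 8.
  apply: hs'; first exact: le_trans (nv_restrict _ _) p2.
  move=> t ts'; rewrite restrictE /=; case: ifP => // ts.
  by apply: ps; rewrite ?mem_cat ?ts' ?orbT.
lra.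
Qed.

(* Gliding hump: the bounded function [phi] agrees with the norming function of
   the [j]-th hump on the finite set where that hump lives. *)
Lemma schur (e : R) : 0 < e ->
  exists N, forall n, (N <= n)%N -> nv (u n) < e.
Proof.
move=> e0; apply: contrapT => hn.
have hu N : exists2 n, (N <= n)%N & e <= nv (u n).
  apply: contrapT => h; apply: hn; exists N => n Nn.
  by rewrite ltNge; apply/negP => en; apply: h; exists n.
have [g gP] := choice (schur_step e0 hu).
(* The successor makes the selected indices strictly increasing, whence [j <= n j]. *)
pose st := fix st j := if j is j'.+1 then ((g (st j')).1.1, (g (st j')).1.2.+1)
  else ([::] : seq T, 0%N).
pose s j := (st j).1; pose n j := (g (st j)).1.2; pose psi j := (g (st j)).2.
have sS j : (g (st j)).1.1 = s j.+1 by [].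
have smono i j : (i <= j)%N -> {subset s i <= s j}.
  elim: j => [|j IH]; first by rewrite leqn0 => /eqP ->.
  rewrite leq_eqVlt => /orP[/eqP -> //|/IH ij] t /ij.
  by have [_ + _ _ _] := gP (st j); apply.
have nge j : (j <= n j)%N.
  have [+ _ _ _ _] := gP (st j); apply: leq_trans.
  elim: j => [//|j IH] /=; rewrite ltnS (leq_trans IH)//.
  by have [] := gP (st j).
(* The sets of newly added coordinates are disjoint because [s] increases, so at most one hump
   prescribes a value at [t]; otherwise 0 is taken. *)
have glue t : exists v : K, nrm v <= 1 /\
    forall j, t \in s j.+1 -> t \notin s j -> v = psi j t.
  have [[j tj tj']|no] := pselect (exists2 j, t \in s j.+1 & t \notin s j); last first.
    exists 0; split; first by rewrite nrm0.
    by move=> j tj tj'; exfalso; apply: no; exists j.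
  exists (psi j t); split.
    by apply: le_trans (nrm_le_linf _ _) _; have [] := gP (st j).
  move=> i ti ti'; have [ij|ji|->//] := ltngtP i j.
    by move: tj'; rewrite (smono _ _ ij _ ti).
  by move: ti'; rewrite (smono _ _ ji _ tj).
have [v vP] := choice glue.
pose phi : B := linf_mk S v.
have phiE : phi = v :> (T -> K).
  by apply: (@linf_mkE _ _ S T _ 1) => t; have [] := vP t.
have phi1 : nv phi <= 1.
  by apply: linf_norm_le => // t; rewrite phiE; have [] := vP t.
have e4 : 0 < e / 4 by lra.
(* Weak nullity makes the pairing of [u (n N)] with [phi] smaller than [e / 4], whereas the pairing
   with [psi N] is at least [e / 2] and replacing it by [phi] costs at most [e / 4]. *)
have [N /(_ _ (nge N))] := pairing_cvg0 phi e4.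
have [_ _ p1 h2 /(_ (psi N - phi)) h4] := gP (st N).
have {}h4 : nrm (pairing (u (n N)) (psi N - phi)) <= e / 4.
  apply: h4; first by have := nvD S (psi N) (- phi); rewrite nvN; move: p1; rewrite -/(psi N); lra.
  move=> t; rewrite sS => tN tN'.
  have -> : (psi N - phi) t = psi N t - phi t by [].
  by rewrite phiE (proj2 (vP t) N tN tN') subrr.
have : psi N = (psi N - phi) + phi by rewrite subrK.
rewrite -/(n N) -/(psi N) in h2 * => ee; rewrite ee pairingD in h2.
have := nrmD S (pairing (u (n N)) (psi N - phi)) (pairing (u (n N)) phi); lra.
Qed.

End Schur.

End SummableFunctions.

(** * Separability of weakly compactly generated spaces *)

Section WcgSeparable.
Context (R : realType) (K : numFieldType) (S : scalars R K).
Context (E : completeNormedModType K) (coord : nat -> dual_space E).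
Local Notation nrm := (nrm S).
Local Notation nv := (nv S).

Hypothesis coord_separating : forall x y : E,
  (forall i, coord i x = coord i y :> K) -> x = y.

(* On a weakly compact set the weak topology is the coarsest one that makes the
   countably many coordinates continuous, hence has a countable dense subset. *)
Lemma weakly_compact_weakly_separable (A : set E) :
  compact (A : set (weak E)) ->
  exists a : seq nat -> E, forall x, A x -> forall f : dual_space E,
    (forall c, f (a c) = 0 :> K) -> f x = 0 :> K.
Proof.
move=> cA; have [q qd] := scalar_separable S.
(* A list [c] names a cell of [A] by approximate values of the first [size c] coordinates. One point
   is picked per nonempty cell; an empty cell yields 0, where every functional vanishes. *)
pose P c x := A x /\ forall i, (i < size c)%N ->
  nrm (coord i x - q (nth 0%N c i)) < (size c).+1%:R^-1.
exists (fun c => xget 0 [set x | P c x]) => x Ax f fa.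
have approx n : exists c, size c = n /\ P c x.
  have h i : exists m, nrm (coord i x - q m) < n.+1%:R^-1.
    by apply: qd; rewrite invr_gt0.
  have [m hm] := choice h.
  exists (mkseq m n); split; first by rewrite size_mkseq.
  by split=> // i; rewrite size_mkseq => ni; rewrite nth_mkseq.
have [c hc] := choice approx.
pose y n := xget 0 [set x | P (c n) x].
have yP n : P (c n) (y n).
  suff : [set x | P (c n) x] (y n) by [].
  by apply: xgetI; exact: (hc n).2.
have [|z [_ Gz]] := cA ((y : nat -> weak E) @ \oo) _.
  by exists 0%N => // n _; exact: (yP n).1.
(* The picked points [y n] approach [x] in every coordinate, so their cluster point is [x]; since
   [f] vanishes on all of them, it vanishes there. *)
suff <- : z = x.
  apply: (weak_cluster_eq (S := S) _ Gz) => e e0.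
  by exists 0%N => // n _ /=; rewrite fa subrr nrm0.
apply: coord_separating => i; apply: (weak_cluster_eq (S := S) _ Gz) => e e0.
have e2 : 0 < e / 2 by lra.
have [N hN] : exists N, N.+1%:R^-1 < e / 2.
  exists (Num.truncn (e / 2)^-1).
  by rewrite invf_plt ?posrE// truncnS_gt.
exists (maxn N i.+1) => // n /=; rewrite geq_max => /andP[Nn ni].
have [cn Px] := hc n.
have := Px.2 i; have := (yP n).2 i; rewrite cn => /(_ ni) h1 /(_ ni) h2.
have h3 : n.+1%:R^-1 <= N.+1%:R^-1 :> R.
  by rewrite lef_pV2 ?posrE ?ltr0n// ler_nat.
have := nrmD S (coord i x - q (nth 0%N (c n) i)) (q (nth 0%N (c n) i) - coord i (y n)).
rewrite subrKA (nrmB S (q _)) => /le_lt_trans; apply.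
apply: lt_le_trans (ltrD h2 h1) _; move: hN h3.
by set a := N.+1%:R^-1; set b := n.+1%:R^-1 => hN h3; lra.
Qed.

(** A functional vanishing on the countable set [a] vanishes on the generating set [A], so by
    separation the closed span of [a] contains [A] and is all of [E]. Combinations with coefficients
    from a countable dense set of scalars are then dense. *)
Lemma wcg_separable : is_wcg E ->
  exists (C : countType) (d : C -> E), forall x (e : R), 0 < e ->
    exists c, nv (x - d c) < e.
Proof.
move=> [A [cA dA]].
have [a ha] := weakly_compact_weakly_separable cA.
have [q qd] := scalar_separable S.
pose W := closed_span S (range a).
have LW : linear_set (cs_set W) by exact: closedSubspace_linear.
have AW : A `<=` cs_set W.
  move=> x Ax; apply: contrapT => nWx.
  have [f [fW /eqP]] := closed_separation S LW (@cs_closed _ _ W) nWx; apply.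
  apply: ha => // c; apply: fW; apply: closed_span_sub; exact: imageT.
have WT x : cs_set W x.
  apply: (@cs_closed _ _ W); apply/(nv_closureP S) => e e0.
  have xe : nbhs x [set y | nv (x - y) < e] by apply/(nv_nbhs S); exists e.
  have [|y [/interior_subset /= xy Ay]] :=
      dA (interior [set y | nv (x - y) < e]) _ (@open_interior _ _).
    by exists x.
  by exists y => //; exact: lin_span_min LW AW _ Ay.
pose d (l : seq (nat * seq nat)) : E := \sum_(p <- l) q p.1 *: a p.2.
exists (seq (nat * seq nat))%type, d.
have dZ k l (e : R) : 0 < e -> exists l', nv (k *: d l - d l') < e.
  elim: l e => [|[m c] l IH] e e0.
    by exists [::]; rewrite /d !big_nil scaler0 subrr nv0.
  have e2 : 0 < e / 2 by lra.
  have a0 : 0 < nv (a c) + 1 by have := nv_ge0 S (a c); lra.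
  have [l' hl'] := IH _ e2; have [m' hm'] := qd (k * q m) _ (divr_gt0 e2 a0).
  exists ((m', c) :: l'); rewrite /d !big_cons /= -/(d l) -/(d l').
  rewrite scalerDr scalerA opprD addrACA -scalerBl.
  rewrite (le_lt_trans (nvD _ _ _))// nvZ.
  rewrite ltr_pdivlMr// in hm'.
  have := nrm_ge0 S (k * q m - q m'); lra.
move=> x; have := WT x; move: x.
apply: closed_span_min_approx.
- split; first by move=> e e0; exists [::]; rewrite /d big_nil subrr nv0.
  move=> k x y hx hy e e0.
  have e3 : 0 < e / 3 by lra.
  have k0 : 0 < nrm k + 1 by have := nrm_ge0 S k; lra.
  have [l hl] := hx _ (divr_gt0 e3 k0); have [l1 hl1] := hy _ e3.
  have [l2 hl2] := dZ k l _ e3.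
  exists (l2 ++ l1); rewrite /d big_cat /= -/(d l2) -/(d l1).
  rewrite ltr_pdivlMr// in hl.
  have -> : k *: x + y - (d l2 + d l1) = k *: (x - d l) + (k *: d l - d l2) + (y - d l1).
    by rewrite scalerBr subrKA opprD addrACA.
  have := nvD S (k *: (x - d l) + (k *: d l - d l2)) (y - d l1).
  have := nvD S (k *: (x - d l)) (k *: d l - d l2); rewrite nvZ.
  have := nv_ge0 S (x - d l); lra.
- move=> _ [c _ <-] e e0.
  have a0 : 0 < nv (a c) + 1 by have := nv_ge0 S (a c); lra.
  have [m hm] := qd 1 _ (divr_gt0 e0 a0); exists [:: (m, c)].
  rewrite /d big_cons big_nil addr0 /= -{1}[a c]scale1r -scalerBl nvZ.
  rewrite ltr_pdivlMr// in hm.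
  have := nrm_ge0 S (1 - q m); lra.
- move=> x hx e e0; have e2 : 0 < e / 2 by lra.
  have [y hy xy] := hx _ e2; have [l hl] := hy _ e2.
  exists l; have := nv_trans S y x (d l); lra.
Qed.

End WcgSeparable.

(** * Uniform boundedness *)

Section UniformBoundedness.
Context (R : realType) (K : numFieldType) (S : scalars R K).
Context (E : completeNormedModType K).
Local Notation nrm := (nrm S).
Local Notation nv := (nv S).

Lemma functional_norming (f : dual_space E) (y : E) : f y <> 0 :> K ->
  exists2 x : E, nv x <= 1 & forall z, nrm (f z) <= 2 * nrm (f x) * nv z.
Proof.
move=> fy; have [M M0 fM] := functional_bound S f.
pose D := [set r | exists2 x : E, nv x <= 1 & r = nrm (f x)].
have hD : has_sup D.
  split; first by exists (nrm (f 0)), 0; rewrite ?nv0.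
  by exists M => _ [x x1 ->]; rewrite (le_trans (fM x))// ler_piMr// ltW.
have y0 : y <> 0 by move=> y0; apply: fy; rewrite y0 linear0.
have scale z : nrm (f z) <= sup D * nv z.
  have [->|/eqP/(nv_gt0 S) z0] := eqVneq z 0; first by rewrite linear0 nrm0 nv0 mulr0.
  rewrite -ler_pdivrMr//; apply: sup_upper_bound => //.
  exists (rl S (nv z)^-1 *: z).
    by rewrite nvZ nrm_rl gtr0_norm ?invr_gt0// mulVf// gt_eqF.
  by rewrite linearZ nrmM nrm_rl gtr0_norm ?invr_gt0// mulrC.
have D0 : 0 < sup D.
  by have := lt_le_trans (nrm_gt0 S fy) (scale y); rewrite pmulr_lgt0// nv_gt0.
have D2 : sup D / 2 < sup D by lra.
have [_ [x x1 ->] xD] := sup_adherent (eps := sup D / 2) (divr_gt0 D0 (ltr0n _ 2)) hD.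
exists x => // z; apply: le_trans (scale z) _; rewrite ler_wpM2r ?nv_ge0//; lra.
Qed.

(* Elementary gliding-hump proof: [f n] is huge at the [n]-th increment
   [5^-n x n] of a convergent sequence, whose tail is too short to compensate. *)
Theorem uniform_boundedness (G : set (dual_space E)) :
  (forall x, exists M : R, forall f, G f -> nrm (f x) <= M) ->
  exists2 C : R, 0 < C & forall f, G f -> forall x, nrm (f x) <= C * nv x.
Proof.
move=> ptw; apply: contrapT => unb.
have big (C : R) : 0 < C -> exists fx : dual_space E * E, [/\ G fx.1, nv fx.2 <= 1,
    C <= nrm (fx.1 fx.2) & forall z, nrm (fx.1 z) <= 2 * nrm (fx.1 fx.2) * nv z].
  move=> C0; have C2 : 0 < 2 * C by lra.
  have [f [Gf [y hy]]] : exists f, G f /\ exists y, 2 * C * nv y < nrm (f y).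
    apply: contrapT => no; apply: unb; exists (2 * C) => // f Gf x.
    by rewrite leNgt; apply/negP => h; apply: no; exists f; split=> //; exists x.
  have fy : f y <> 0 :> K.
    by move=> fy; move: hy; rewrite fy nrm0 ltNge mulr_ge0 ?nv_ge0// ltW.
  have [x x1 hx] := functional_norming fy; exists (f, x); split=> //=.
  have y0 : 0 < nv y by apply: nv_gt0 => y0; apply: fy; rewrite y0 linear0.
  by have := lt_le_trans hy (hx y); rewrite ltr_pM2r// ltr_pM2l// => /ltW.
have [g gP] : exists g : nat -> dual_space E * E, forall n, [/\ G (g n).1,
    nv (g n).2 <= 1, n.+1%:R * 5 ^+ n <= nrm ((g n).1 (g n).2) &
    forall z, nrm ((g n).1 z) <= 2 * nrm ((g n).1 (g n).2) * nv z].
  have [n|g] := @choice _ _ (fun n fx => [/\ G fx.1,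
    nv fx.2 <= 1, n.+1%:R * 5 ^+ n <= nrm (fx.1 fx.2) &
    forall z, nrm (fx.1 z) <= 2 * nrm (fx.1 fx.2) * nv z]); last by exists g.
  by apply: big; rewrite mulr_gt0 ?exprn_gt0.
pose f n := (g n).1; pose x n := (g n).2; pose a n := nrm (f n (x n)).
pose r n : R := 5^-1 ^+ n.
have r0 n : 0 < r n by rewrite exprn_gt0// invr_gt0.
have rS n : r n.+1 = r n / 5 by rewrite /r exprSr.
(* The values of [f n] at the two candidates differ by [2 * a n * r n] in modulus, so one of the
   signs makes it large whatever [s] is. *)
pose inc n (s : E) := if a n * r n <= nrm (f n (s + rl S (r n) *: x n))
  then s + rl S (r n) *: x n else s - rl S (r n) *: x n.
have inc_close n s : nv (inc n s - s) <= r n.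
  have h : nv (rl S (r n) *: x n) <= r n.
    by rewrite nvZ nrm_rl gtr0_norm// ler_piMr//; [exact: ltW|have [] := gP n].
  by rewrite /inc; case: ifP => _; rewrite addrAC subrr add0r ?nvN.
have inc_big n s : a n * r n <= nrm (f n (inc n s)).
  rewrite /inc; case: ifP => // /negbT; rewrite -ltNge => h.
  have fz : nrm (f n (rl S (r n) *: x n)) = a n * r n.
    by rewrite linearZ nrmM nrm_rl gtr0_norm// mulrC.
  have := nrmD S (f n (s + rl S (r n) *: x n)) (- f n (s - rl S (r n) *: x n)).
  rewrite nrmN.
  have -> : f n (s + rl S (r n) *: x n) - f n (s - rl S (r n) *: x n) =
      f n (rl S (r n) *: x n) + f n (rl S (r n) *: x n) :> K.
    by rewrite linearB linearD /=; ring.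
  by rewrite -nrmMn2 fz mulr2n; lra.
pose s := fix s n := if n is n'.+1 then inc n (s n') else inc 0%N 0.
have s_close n k : nv (s (n + k)%N - s n) <= r n / 4 - r (n + k)%N / 4.
  elim: k => [|k IH]; first by rewrite addn0 !subrr nv0.
  rewrite addnS; have := inc_close (n + k).+1 (s (n + k)%N).
  have := nv_trans S (s (n + k)%N) (s (n + k).+1) (s n).
  rewrite rS /=; lra.
have {}s_close n m : (n <= m)%N -> nv (s m - s n) <= r n / 4.
  move=> nm; have := s_close n (m - n)%N; rewrite subnKC//.
  have := r0 m; lra.
have r_small (e : R) : 0 < e -> exists n, r n < e.
  move=> e0; exists (Num.truncn e^-1); rewrite /r exprVn invf_plt ?posrE ?exprn_gt0//.
  apply: lt_le_trans (truncnS_gt _) _; rewrite -natrX ler_nat.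
  exact: ltn_expl.
have [l sl] : exists l, s @ \oo --> (l : E).
  apply/cvg_ex; apply: cauchy_cvg; apply/cauchyP => e e0.
  have e0' : 0 < nrm e by rewrite -(rl_gt0 S) -rl_nrm_id// ltW.
  have [n rn] := r_small _ e0'; exists (s n).
  suff : (\oo : set_system nat) [set m | ball (s n) e (s m)] by [].
  exists n => // m /= /s_close nm; rewrite -ball_normE /= (nvE S) (rl_nrm_id S (ltW e0)) rl_lt.
  by rewrite (nvB S); have := r0 n; lra.
have l_close n : nv (l - s n) <= r n / 4.
  apply/ler_addgt0Pr => e e0.
  have /(nv_cvg S)/(_ e e0)[N _ hN] := sl.
  have := hN (maxn N n) (leq_maxl _ _); have := s_close n (maxn N n) (leq_maxr _ _).
  by have := nv_trans S (s (maxn N n)) l (s n); rewrite /=; lra.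
have [M hM] := ptw l.
(* With ratio 1/5 the remaining tail has norm at most [r n / 4] and costs [a n * r n / 2]. What is
   left of [f n l] is at least [a n * r n / 2], hence at least [n.+1 / 2]. *)
have [n nM] : exists n, 2 * M < n.+1%:R by exists (Num.truncn (2 * M)); exact: truncnS_gt.
have [Gn _ an fn] := gP n; have := hM _ Gn.
have := fn (s n - l); rewrite linearB /= (nvB S).
have := l_close n; rewrite -/(f n) -/(x n) -/(a n) in fn an *.
have a0 : 0 <= a n by exact: nrm_ge0.
have fs : a n * r n <= nrm (f n (s n)) by case: (n) => [|n'] /=; exact: inc_big.
have ar : n.+1%:R <= a n * r n.
  by rewrite /r exprVn ler_pdivlMr// exprn_gt0.
move=> lc fsl fl; have := nrmD S (f n (s n) - f n l) (f n l); rewrite subrK.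
have : 2 * a n * nv (l - s n) <= 2 * a n * (r n / 4) by rewrite ler_wpM2l ?mulr_ge0.
lra.
Qed.

End UniformBoundedness.

(** * The step operator *)

Lemma mem_In (T : eqType) (x : T) (s : seq T) : x \in s -> List.In x s.
Proof.
by elim: s => [//|y s IH]; rewrite inE => /orP[/eqP ->|/IH]; [left|right].
Qed.

Lemma reals_uncountable (R : realType) : ~ countable [set: R].
Proof.
move=> cR; have c01 : countable (`[0, 1]%classic : set R).
  by apply: sub_countable cR; exact: subset_card_le.
have := countable_lebesgue_measure0 c01.
rewrite lebesgue_measure_itv /= lte_fin ltr01 oppr0 adde0 => /eqP.
by rewrite eqe oner_eq0.
Qed.

Section DualVariation.
Context (R : realType) (K : numFieldType) (S : scalars R K).
Context (d : Order.disp_t) (P : orderType d).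
Local Notation nrm := (nrm S).

Lemma variation_nondecreasing (b : P -> bool) s :
  (forall p q, p <= q -> b p ==> b q)%O -> sorted <%O s ->
  variation S (fun p => (b p)%:R) s <= 1.
Proof.
move=> bm; case: s => [_ /=|p s /= ps]; first exact: ler01.
suff : path_variation S (fun p => (b p)%:R) p s <= 1 - (b p)%:R.
  by move=> /le_trans; apply; rewrite lerBlDr lerDl.
elim: s p ps => [|q s IH] p /=; first by rewrite subr_ge0; case: (b p).
move=> /andP[pq /IH{}IH]; have /implyP := bm p q (ltW pq).
case: (b p) (b q) IH => [] [] IH; rewrite ?subrr ?subr0 ?nrm0 ?nrm1 ?add0r//.
- by move=> _; move: IH; rewrite subrr.
- by move=> /(_ isT).
- by move=> _; move: IH; rewrite subrr; lra.
by move=> _; move: IH; rewrite subr0.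
Qed.

Lemma variation_nonincreasing (b : P -> bool) s :
  (forall p q, p <= q -> b q ==> b p)%O -> sorted <%O s ->
  variation S (fun p => (b p)%:R) s <= 1.
Proof.
move=> bm; case: s => [_ /=|p s /= ps]; first exact: ler01.
suff : path_variation S (fun p => (b p)%:R) p s <= (b p)%:R.
  by move=> /le_trans; apply; case: (b p).
elim: s p ps => [|q s IH] p /=; first by case: (b p).
move=> /andP[pq /IH{}IH]; have /implyP := bm p q (ltW pq).
case: (b p) (b q) IH => [] [] IH; rewrite ?subrr ?subr0 ?sub0r ?nrmN ?nrm0 ?nrm1 ?add0r//.
- by move=> _; move: IH => /=; lra.
- by move=> /(_ isT).
Qed.

(* The variation of [L \o u] is the value of [L] at a combination of increments
   of [u] with unimodular coefficients. *)
Lemma variation_dual (W : lmodType K) (u : P -> W) (L : W -> K) s :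
  (forall k x y, L (k *: x + y) = k * L x + L y) ->
  exists w : W, L w = rl S (variation S (L \o u) s) /\
    forall l : W -> K, (forall k x y, l (k *: x + y) = k * l x + l y) ->
      nrm (l w) <= variation S (l \o u) s.
Proof.
have lin0 (l : W -> K) : (forall k x y, l (k *: x + y) = k * l x + l y) -> l 0 = 0.
  by move=> lL; have := lL (-1) 0 0; rewrite scaleN1r oppr0 addr0 mulN1r addNr.
have linB (l : W -> K) x y : (forall k x y, l (k *: x + y) = k * l x + l y) ->
    l (x - y) = l x - l y.
  by move=> lL; have := lL (-1) y x; rewrite scaleN1r mulN1r addrC => ->; rewrite addrC.
move=> LL; case: s => [|p s] /=.
  by exists 0; rewrite lin0// rmorph0; split=> // l lL; rewrite lin0// nrm0.
elim: s p => [|q s IH] p /=.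
  by exists 0; rewrite lin0// rmorph0; split=> // l lL; rewrite lin0// nrm0.
have [w [Lw hw]] := IH q.
exists (phase S (L (u q) - L (u p)) *: (u q - u p) + w); split.
  by rewrite LL linB// phaseM Lw rmorphD.
move=> l lL; rewrite lL linB// (le_trans (nrmD _ _ _))// lerD ?hw//.
by rewrite nrmM ler_piMl ?nrm_ge0// nrm_phase.
Qed.

End DualVariation.

Lemma l1_completely_continuous (R : realType) (K : numFieldType)
    (S : scalars R K) (I : eqType) (F : completeNormedModType K)
    (T : operator (subspace_banach (l1 S I)) F) :
  completely_continuous K _ _ T.
Proof.
move=> u l ul.
have [M M0 TM] := operator_bound S T.
have u0 : ((fun n => u n - l) : nat -> weak (subspace_banach (l1 S I))) @ \oo -->
    (0 : weak (subspace_banach (l1 S I))).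
  apply/(weak_cvgP S) => f e e0.
  have /(weak_cvgP S)/(_ f e e0) := ul; apply: filterS => n /=.
  by rewrite linear0 linearB sub0r nrmN (nrmB S).
apply/cvg_ex; exists (T l); apply/(nv_cvg S) => e e0.
have [N hN] := schur u0 (divr_gt0 e0 M0).
exists N => // n /= /hN; rewrite ltr_pdivlMr// => h.
have -> : T l - T (u n) = T (l - u n) by rewrite linearB.
by apply: le_lt_trans (TM _) _; rewrite mulrC (nvB S).
Qed.

Section StepOperator.
Context (R : realType) (K : numFieldType) (S : scalars R K).
Local Notation nrm := (nrm S).
Local Notation nv := (nv S).
Local Notation X := (subspace_banach (l1 S R)).
Local Notation F := (linf S rat).

Definition step_function (q : rat) : linf S R := linf_mk S (fun t => (t <= ratr q)%R%:R).

Lemma step_functionE q t : step_function q t = (t <= ratr q)%R%:R.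
Proof.
rewrite /step_function (@linf_mkE _ _ S R _ 1)// => x.
by case: (x <= _); rewrite ?nrm0 ?nrm1.
Qed.

Lemma nv_step_function q : nv (step_function q) <= 1.
Proof.
apply: linf_norm_le => // t; rewrite step_functionE.
by case: (t <= _); rewrite ?nrm0 ?nrm1.
Qed.

Lemma pairing_le2 (x : X) (phi : linf S R) : nv phi <= 1 ->
  nrm (pairing x phi) <= 2 * nv x.
Proof.
move=> p1; apply: le_trans (pairing_le _ _) _.
by rewrite ler_wpM2r ?nv_ge0// /weight; lra.
Qed.

(* An element of l^1(R) is an atomic measure, and [T] sends it to its
   distribution function. *)
Lemma step_operator_exists : exists T : operator X F,
  forall x q, T x q = pairing x (step_function q).
Proof.
pose f (x : X) : F := linf_mk S (fun q => pairing x (step_function q)).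
have fE x q : f x q = pairing x (step_function q).
  rewrite /f (@linf_mkE _ _ S rat _ (2 * nv x))// => q'.
  exact/pairing_le2/nv_step_function.
have [k x y|x|T fT] := @operator_of _ _ S X F f 2.
- by apply/val_inj/funext => q; rewrite [LHS]fE pairingDl -!fE.
- apply: linf_norm_le => [|q]; first by rewrite mulr_ge0// nv_ge0.
  by rewrite fE; exact/pairing_le2/nv_step_function.
by exists T => x q; rewrite -fT.
Qed.

Variable T : operator X F.
Hypothesis TE : forall x q, T x q = pairing x (step_function q).

Lemma step_operator_delta t q : T (l1_delta S t) q = (t <= ratr q)%R%:R.
Proof. by rewrite TE pairing_delta step_functionE. Qed.

Lemma step_operator_separated s t : s <> t ->
  1 <= nv (T (l1_delta S s) - T (l1_delta S t)).
Proof.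
wlog st : s t / s < t.
  move=> wst sNt; have [st|ts|//] := ltgtP s t; first exact: wst.
  by rewrite (nvB S); apply: wst => // /esym.
move=> _; have [q] := rat_in_itvoo st; rewrite in_itv /= => /andP[sq qt].
apply: le_trans (nrm_le_linf _ q).
have -> : (T (l1_delta S s) - T (l1_delta S t)) q =
  T (l1_delta S s) q - T (l1_delta S t) q by [].
by rewrite !step_operator_delta (ltW sq) (lt_geF qt) subr0 nrm1.
Qed.

Lemma step_operator_not_wcg : ~ wcg_op K _ _ T.
Proof.
move=> [Z [wZ TZ]].
(* The evaluations at the rationals, enumerated by their codes; a number that codes no rational
   repeats the evaluation at 0. *)
have ex (i : nat) : exists f : dual_space (subspace_banach Z),
    forall z, f z = (val z) (odflt 0 (unpickle i)).
  set q := odflt _ _.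
  have [||f Ef] := @functional_of _ _ S (subspace_banach Z) (fun z => val z q) 1.
  - by move=> k x y; rewrite subspace_val_linear.
  - by move=> z; rewrite mul1r nv_subspace; exact: nrm_le_linf.
  by exists f => z; rewrite -Ef.
have [coord cE] := choice ex.
have [|C [d dP]] := @wcg_separable _ _ S _ coord _ wZ.
  move=> x y xy; apply/val_inj/val_inj/funext => q.
  by have := xy (pickle q); rewrite !cE pickleK.
(* Images of distinct unit vectors are at distance at least 1, so a countable dense family
   approximating each within 1/2 would inject R into a countable set. *)
have ch t : exists c, exists2 z : subspace_banach Z,
    val z = T (l1_delta S t) & nv (z - d c) < 2^-1.
  have [z zt] := subspace_val_surj (TZ _ (imageT T (l1_delta S t))).
  have h : 0 < 2^-1 :> R by rewrite invr_gt0.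
  by have [c hc] := dP z _ h; exists c, z.
have [c hc] := choice ch.
apply: (@reals_uncountable R); apply/countable_injP.
exists (fun t => pickle (c t)) => s t _ _ /(pcan_inj pickleK) cst.
apply: contrapT => /step_operator_separated.
have [z zs h1] := hc s; have [w wt h2] := hc t.
rewrite -zs -wt; apply/negP; rewrite -ltNge.
have -> : val z - val w = val (z - w) by [].
rewrite -nv_subspace; apply: le_lt_trans (nv_trans S (d (c s)) z w) _.
have := ltrD h1 h2; rewrite (_ : 2^-1 + 2^-1 = 1); last by lra.
by rewrite cst (nvB S w).
Qed.

(** The variation is the pairing of [x] with a combination of increments of step functions. At each
    [t] this combination is bounded by the variation of [q -> (t <= q)], which is at most 1. *)
Lemma step_operator_variation x s : sorted <%O s ->
  variation S (T x : rat -> K) s <= 2 * nv x.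
Proof.
move=> ss.
have [w [Lw hw]] := @variation_dual _ _ S _ _ _ step_function (pairing x) s (pairingDr x).
have -> : (T x : rat -> K) = pairing x \o step_function.
  by apply/funext => q; exact: TE.
have : nrm (pairing x w) <= 2 * nv x.
  apply: pairing_le2; apply: linf_norm_le => // t.
  apply: (le_trans (hw (fun phi => phi t) _)) => //.
  have -> : (fun phi : linf S R => phi t) \o step_function =
      (fun q => (t <= ratr q)%R%:R) by apply/funext => q; exact: step_functionE.
  apply: variation_nondecreasing ss => p q pq; apply/implyP => /le_trans; apply.
  by rewrite ler_rat.
by rewrite Lw nrm_rl; apply: le_trans; exact: ler_norm.
Qed.

Lemma variation_eq0 (h : rat -> K) s : (forall q, h q = 0) -> variation S h s = 0.
Proof.
move=> h0; have := variationZ S 0 h s; rewrite nrm0 mul0r => <-.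
by congr variation; apply/funext => q; rewrite h0 mulr0.
Qed.

Lemma step_operator_strictly_singular : strictly_singular K _ _ T.
Proof.
move=> M infM [c c0 hc]; apply: infM.
have LM := closedSubspace_linear M.
pose c' := nrm c; have c'0 : 0 < c' by rewrite -(rl_gt0 S) -rl_nrm_id// ltW.
have {}hc x : cs_set M x -> c' * nv x <= nv (T x).
  by move=> /hc; rewrite !(nvE S) [c](rl_nrm_id S (ltW c0)) -rmorphM rl_le.
have Tinj x : cs_set M x -> (forall q, T x q = 0) -> x = 0.
  move=> Mx Tx; have T0 : T x = 0 by apply/val_inj/funext => q; exact: Tx.
  apply: (@nv_eq0 _ _ S); apply/eqP; rewrite eq_le nv_ge0 andbT.
  by rewrite -(pmulr_rle0 _ c'0) (le_trans (hc _ Mx))// T0 nv0.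
pose N := [set h | exists2 x, cs_set M x & h = T x :> (rat -> K)].
(* One factor 2 comes from [step_operator_variation], the other from [linf_norming]; [c'] is the
   lower bound of [T] on [M]. *)
have [|||s hs] := @finite_dim_of_variation_le_sup _ _ S _ rat N (4 / c').
- by exists 0; [exact: LM.1|rewrite linear0].
- move=> k _ _ [x Mx ->] [y My ->]; exists (k *: x + y); first exact: LM.2.
  by rewrite linearP.
- move=> _ [x Mx ->].
  have [x0|Tx0] := pselect (T x = 0).
    exists 0 => s _; rewrite x0 variation_eq0//.
    by rewrite mulr_ge0 ?nrm_ge0// divr_ge0// ltW.
  have [q hq] := linf_norming Tx0; exists q => s ss.
  apply: (le_trans (step_operator_variation x ss)).
  rewrite mulrAC ler_pdivlMr//; have := hc _ Mx; lra.
have [| |A fA MA] := @finite_span_of_functionals K X rat (fun q x => T x q) s (cs_set M) _ LM.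
- by move=> q k x y; rewrite linearP.
- move=> x Mx xs; apply: Tinj => //; apply: hs; first by exists x.
  by move=> p /mem_In; exact: xs.
by exists A.
Qed.

(** The same argument with the variables exchanged. The vector [w] is returned so that any bound for
    [f] on the unit ball becomes a bound for the variation. *)
Lemma step_operator_dual_variation (f : dual_space F) s : sorted <%O s ->
  exists2 w : F, nv w <= 1 &
    f w = rl S (variation S (fun t => f (T (l1_delta S t)) : K) s) :> K.
Proof.
move=> ss.
have [w [Lw hw]] := @variation_dual _ _ S _ _ _ (fun t => T (l1_delta S t))
  (f : F -> K) s (functionalP f).
exists w => //; apply: linf_norm_le => // q.
apply: (le_trans (hw (fun y => y q) _)) => //.
have -> : (fun y : F => y q) \o (fun t => T (l1_delta S t)) =
  (fun t => (t <= ratr q)%R%:R) by apply/funext => t; exact: step_operator_delta.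
apply: variation_nonincreasing ss => p t pt; apply/implyP => h.
exact: le_trans pt h.
Qed.

(** The sum of a closed subspace and a finite-dimensional one is closed. To adjoin [v] outside [M'],
    take [f] vanishing on [M'] but not at [v]: the new space is the preimage of [M'] under the
    continuous projection [g] along [v]. *)
Lemma closed_add_finite (M : set F) (l : seq F) : linear_set M -> closed M ->
  exists M', [/\ linear_set M', closed M', M `<=` M', {subset l <= M'} &
    forall y, M' y -> exists2 a, lin_span [set` l] a & M (y - a)].
Proof.
move=> LM cM; elim: l => [|v l [M' [L' c' MM' lM' hM']]].
  exists M; split=> // y My; exists 0; first exact: (lin_span_linear _).1.
  by rewrite subr0.
have ll : lin_span [set` l] `<=` lin_span [set` v :: l].
  by apply: lin_spanS => x /=; rewrite inE => ->; rewrite orbT.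
have [M'v|M'v] := pselect (M' v).
  exists M'; split=> //.
    by move=> x; rewrite inE => /orP[/eqP ->|/lM'//]; exact: mem_set.
  by move=> y /hM'[a /ll]; exists a.
have [f [fM fv]] := closed_separation S L' c' M'v.
pose g y := y - (f y / f v) *: v.
have gL k x y : g (k *: x + y) = k *: g x + g y.
  rewrite /g functionalP scalerBr scalerA addrACA -opprD -scalerDl.
  by congr (_ - _ *: _); rewrite mulrDl mulrA.
have gM y : M' y -> g y = y by move=> /fM fy; rewrite /g fy mul0r scale0r subr0.
have gv : g v = 0 by rewrite /g divff// scale1r subrr.
exists [set y | M' (g y)]; split.
- split; first by rewrite /= gM; exact: L'.1.
  by move=> k x y /= Mx My; rewrite gL; exact: L'.2.
- move=> y /(nv_closureP S) hy /=; apply: c'; apply/(nv_closureP S) => e e0.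
  have [C C0 fC] := functional_bound S f.
  pose D := 1 + C / nrm (f v) * nv v.
  have D0 : 0 < D.
    by rewrite ltr_wpDr// mulr_ge0 ?nv_ge0// divr_ge0 ?nrm_ge0// ltW.
  have [z Mz yz] := hy _ (divr_gt0 e0 D0); exists (g z) => //.
  have -> : g y - g z = g (y - z).
    by have := gL (-1) z y; rewrite !scaleN1r addrC => ->; rewrite addrC.
  apply: le_lt_trans (nvD _ _ _) _; rewrite nvN nvZ nrmM nrmV.
  rewrite ltr_pdivlMr// mulrC in yz; apply: le_lt_trans yz.
  rewrite /D mulrDl mul1r lerD2l [leRHS]mulrAC ler_wpM2r ?nv_ge0//.
  by rewrite [leRHS]mulrAC ler_wpM2r ?invr_ge0 ?nrm_ge0.
- by move=> y My /=; rewrite gM; exact: MM'.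
- move=> x; rewrite inE => /orP[/eqP ->|/lM' /set_mem xM].
    by apply: mem_set; rewrite /= gv; exact: L'.1.
  by apply: mem_set; rewrite /= gM.
- move=> y /hM'[a al May]; exists ((f y / f v) *: v + a).
    apply: (lin_span_linear _).2; last exact: ll.
    by apply: sub_lin_span; rewrite /= inE eqxx.
  by rewrite opprD addrA.
Qed.

Lemma functional_comb (E : normedModType K) k (f g : dual_space E) :
  exists h : dual_space E, forall x, h x = k * f x + g x :> K.
Proof.
have [M M0 fM] := functional_bound S f; have [M' M'0 gM] := functional_bound S g.
have [||h Eh] := @functional_of _ _ S E (fun x => k * f x + g x : K) (nrm k * M + M').
- by move=> c x y; rewrite !functionalP; ring.
- move=> x; rewrite (le_trans (nrmD _ _ _))// mulrDl lerD// nrmM -mulrA.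
  by rewrite ler_wpM2l ?nrm_ge0.
by exists h => x; rewrite -Eh.
Qed.

Lemma functional0 (E : normedModType K) : exists h : dual_space E, forall x, h x = 0 :> K.
Proof.
have [||h Eh] := @functional_of _ _ S E (fun=> 0) 0.
- by move=> *; rewrite mulr0 addr0.
- by move=> x; rewrite nrm0 mul0r.
by exists h => x; rewrite -Eh.
Qed.

Lemma functional_comp (E G : normedModType K) (U : operator E G) (f : dual_space G) :
  exists h : dual_space E, forall x, h x = f (U x).
Proof.
have [M M0 UM] := operator_bound S U; have [M' M'0 fM] := functional_bound S f.
have [||h Eh] := @functional_of _ _ S E (fun x => f (U x) : K) (M' * M).
- by move=> c x y; rewrite linearP functionalP.
- by move=> x; rewrite (le_trans (fM _))// -mulrA ler_wpM2l// ltW.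
by exists h => x; rewrite -Eh.
Qed.

Lemma step_operator_strictly_cosingular : strictly_cosingular K _ _ T.
Proof.
move=> M infM surj; apply: infM.
have LM := closedSubspace_linear M.
have dec y : exists x, cs_set M (y - T x).
  have [x _ /= xy] := surj _ (imageT (quotient_map M) y).
  exists x; have : quotient_map M y y by rewrite /quotient_map /= subrr; exact: LM.1.
  by rewrite -xy.
pose perp := [set f : dual_space F | forall m, cs_set M m -> f m = 0 :> K].
(* Surjectivity modulo [M] gives pointwise boundedness: if [y - T x] lies in [M], then
   [f y = f (T x)] is the pairing of [x] with [t -> f(v_t)], hence at most [2 * nv x]. *)
have [C C0 hC] : exists2 C : R, 0 < C & forall f, (perp `&`
    [set f | forall t, nrm (f (T (l1_delta S t))) <= 1]) f ->
    forall y, nrm (f y) <= C * nv y.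
  apply: uniform_boundedness => y; have [x Mx] := dec y.
  exists (2 * nv x) => f [fM f1].
  have [h hE] := functional_comp T f.
  have [phi phiE hphi] := pairing_represents h.
  have -> : f y = pairing x phi :> K.
    rewrite -hphi hE; apply/eqP; rewrite -subr_eq0; apply/eqP.
    by have := fM _ Mx; rewrite linearB.
  apply: pairing_le2; apply: linf_norm_le => // t.
  by rewrite phiE hE.
have {}hC (f : dual_space F) (r : R) : perp f -> 0 < r ->
    (forall t, nrm (f (T (l1_delta S t))) <= r) -> forall y, nrm (f y) <= r * C * nv y.
  move=> fM r0 fr y.
  have [z zE] := functional0 F; have [g gE] := functional_comb (rl S r^-1) f z.
  have := hC g _ y; rewrite gE zE addr0 nrmM nrm_rl gtr0_norm ?invr_gt0//.
  rewrite mulrC ler_pdivrMr// mulrC mulrA; apply; split.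
    by move=> m Mm; rewrite gE zE fM// mulr0 addr0.
  move=> t /=; rewrite gE zE addr0 nrmM nrm_rl gtr0_norm ?invr_gt0//.
  by rewrite mulrC ler_pdivrMr// mul1r.
pose N := [set h : R -> K | exists2 f : dual_space F, perp f &
  h = fun t => f (T (l1_delta S t))].
have [|||s hs] := @finite_dim_of_variation_le_sup _ _ S _ R N (2 * C).
- have [z zE] := functional0 F; exists z; first by move=> m _; rewrite zE.
  by apply/funext => t; rewrite zE.
- move=> k _ _ [f fM ->] [g gM ->]; have [h hE] := functional_comb k f g.
  exists h; last by apply/funext => t; rewrite hE.
  by move=> m Mm; rewrite hE fM// gM// mulr0 addr0.
- move=> _ [f fM ->].
  have [g gE] := functional_comp T f.
  have [phi phiE _] := pairing_represents g.
  have fphi t : f (T (l1_delta S t)) = phi t :> K by rewrite phiE gE.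
  have [phi0|phi0] := pselect (phi = 0).
    exists 0 => s _; rewrite (_ : (fun t => f (T (l1_delta S t)) : K) = (fun t => 0 * phi t)).
      by rewrite variationZ nrm0 mul0r mulr_ge0 ?nrm_ge0// mulr_ge0// ltW.
    by apply/funext => t; rewrite fphi phi0 mul0r.
  have [t ht] := linf_norming phi0; exists t => s ss.
  (* The variation is [f w] with [nv w <= 1]; applying [hC] with radius [2 * nrm (phi t)], an upper
     bound for [phi], yields the constant [2 * C]. *)
  have [w w1 fw] := step_operator_dual_variation f ss.
  have ft0 : 0 < 2 * nrm (phi t) by apply: lt_le_trans ht; exact: nv_gt0.
  have := hC f _ fM ft0 _ w.
  have h t' : nrm (f (T (l1_delta S t'))) <= 2 * nrm (phi t).
    by rewrite fphi (le_trans (nrm_le_linf _ _)).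
  move=> /(_ h); rewrite fw nrm_rl => /(le_trans (ler_norm _)) /le_trans; apply.
  rewrite fphi [leRHS]mulrAC ler_piMr// mulr_ge0 ?mulr_ge0 ?nrm_ge0//; exact: ltW.
have perp0 f : perp f -> (forall t, t \in s -> f (T (l1_delta S t)) = 0 :> K) ->
    forall y, f y = 0 :> K.
  move=> fM fs y; apply: (@nrm_eq0 _ _ S); apply/eqP; rewrite eq_le nrm_ge0 andbT.
  have f0 : forall t, f (T (l1_delta S t)) = 0 :> K.
    by apply: (hs (fun t => f (T (l1_delta S t)) : K)) fs; exists f.
  (* [hC] takes a positive radius, so the vanishing of [f] on all [v_t] is used with arbitrarily
     small radii. *)
  have D0 : 0 < C * nv y + 1 by rewrite ltr_wpDl// mulr_ge0 ?nv_ge0// ltW.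
  apply/ler_addgt0Pr => e e0; rewrite add0r.
  have ed := divr_gt0 e0 D0.
  apply: (le_trans (hC f (e / (C * nv y + 1)) fM ed _ y)) => [t|].
    by rewrite f0 nrm0 ltW.
  by rewrite -mulrA mulrAC ler_pdivrMr// ler_pM2l//; lra.
pose l := [seq T (l1_delta S t) | t <- s].
have [M' [L' c' MM' lM' hM']] := @closed_add_finite (cs_set M) l LM (@cs_closed _ _ M).
(* A functional vanishing on [M'] lies in [perp] and vanishes at the [v_t] with [t] in [s], so it is
   zero; by separation the closed space [M'] is everything. *)
have M'T y : M' y.
  apply: contrapT => M'y; have [f [fM' /eqP fy]] := closed_separation S L' c' M'y.
  apply: fy; apply: perp0 => [m /MM'/fM'//|t ts].
  by apply: fM'; apply: set_mem; apply: lM'; exact: map_f.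
exists [set` l]; first exact: finite_seq.
move=> _ [y _ <-]; have [a al May] := hM' y (M'T y).
exists a => //; apply/seteqP; split=> z; rewrite /quotient_map /= => Mz.
  by rewrite -[z - y](subrKA a) -(opprB y a); exact: linear_setB.
by rewrite -[z - a](subrKA y); exact: linear_setD.
Qed.

End StepOperator.

Theorem proposition2p5 (R : realType) (K : numFieldType)
    (hK : scalar_field R K) :
  proper_subclass (weakly_compact_op K) (wcg_op K) /\
  (incomparable (completely_continuous K) (wcg_op K) /\
   incomparable (strictly_singular K) (wcg_op K) /\
   incomparable (strictly_cosingular K) (wcg_op K)).
Proof.
have [S] := scalars_of_scalar_field hK.
have [J [wJ nW nV nS nCS]] := c0_identity S.
have [T TE] := step_operator_exists S.
have nT := step_operator_not_wcg TE.
split; first by split; [exact: weakly_compact_wcg S|move=> /(_ _ _ _ wJ)].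
split; [|split]; split.
- by move=> /(_ _ _ _ (@l1_completely_continuous _ _ S _ _ T)).
- by move=> /(_ _ _ _ wJ).
- by move=> /(_ _ _ _ (@step_operator_strictly_singular _ _ S T TE)).
- by move=> /(_ _ _ _ wJ).
- by move=> /(_ _ _ _ (@step_operator_strictly_cosingular _ _ S T TE)).
- by move=> /(_ _ _ _ wJ).
Qed.
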